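(* Let $n=2^rp$, where $p$ is an odd prime and $r\ge 2$. Let $S$ be a sequence in $\mathbb{Z}_n$ which has exactly one odd term. Then $S$ is a $U(n)$-extremal sequence for the Gao constant if and only if $S$ is $U(n)$-equivalent to a sequence having one of the following forms: $(\star)$ $\ (b_1,\ p_1b_2,\ p_1p_2b_3,\ \ldots,\ p_1\cdots p_rb_{r+1},\ \underbrace{0,\ldots,0}_{n-1\text{ times}})$, where $p_1,\ldots,p_{r+1}$ are primes with $n=p_1p_2\cdots p_{r+1}$ (in some order) and $b_1,\ldots,b_{r+1}$ are integers with $b_i$ coprime to $p_i$ for each $1\le i\le r+1$; $(\ast)$ $\ (b_1,\ p_1b_2,\ p_1p_2b_3,\ \ldots,\ p_1\cdots p_{r-1}b_r,\ \underbrace{n/2,\ldots,n/2}_{m\text{ times}},\ \underbrace{0,\ldots,0}_{n-m\text{ times}})$, where $p_1,\ldots,p_r$ are primes with $n=2p_1p_2\cdots p_r$ (in some order), $b_1,\ldots,b_r$ are integers with $b_i$ coprime to $p_i$ for each $1\le i\le r$, and $m$ is an odd integer with $1\le m\le n$; $(\ast\ast)$ $\ (a_0,\ 2a_1,\ \ldots,\ 2^{r-2}a_{r-2},\ c,\ 2^{r-1},\ \underbrace{n/2,\ldots,n/2}_{n-1\text{ times}})$, where $a_0,\ldots,a_{r-2}$ are odd integers and $c$ is an integer divisible by $2^r$.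
   Context: $\mathbb{Z}_n=\mathbb{Z}/n\mathbb{Z}$ and $U(n)$ is its group of units; integers are identified with their images in $\mathbb{Z}_n$. For even $n$, an element of $\mathbb{Z}_n$ is odd if it is the image of an odd integer; terms of a sequence are counted with multiplicity. A sequence is a finite list $(x_1,\ldots,x_l)$ of elements of $\mathbb{Z}_n$ (repetitions allowed); a subsequence is obtained by restricting to a subset of the indices. For $A\subseteq\mathbb{Z}_n$, a subsequence of $(x_1,\ldots,x_l)$ with index set $I$ is an $A$-weighted zero-sum subsequence if $I\ne\emptyset$ and there exist $a_i\in A$ ($i\in I$) with $\sum_{i\in I}a_ix_i=0$. The $A$-weighted Gao constant $E_A(n)$ is the least positive integer $k$ such that every sequence of length $k$ in $\mathbb{Z}_n$ has an $A$-weighted zero-sum subsequence of length $n$. An $A$-extremal sequence for the Gao constant is a sequence in $\mathbb{Z}_n$ of length $E_A(n)-1$ which has no $A$-weighted zero-sum subsequence of length $n$. For a subgroup $A$ of $U(n)$, two sequences $(x_1,\ldots,x_l)$ and $(y_1,\ldots,y_l)$ in $\mathbb{Z}_n$ are $A$-equivalent if there exist $c\in U(n)$, a permutation $\sigma$ of $\{1,\ldots,l\}$ and $a_1,\ldots,a_l\in A$ such that $c\,y_{\sigma(i)}=a_ix_i$ for all $1\le i\le l$. *)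

(* Defs.v *)
From mathcomp Require Import all_boot all_order all_algebra all_fingroup.
Set Implicit Arguments.
Unset Strict Implicit.
Unset Printing Implicit Defensive.
Import GRing.Theory.
Local Open Scope ring_scope.

(* Throughout, 'Z_n is the ring Z/nZ only for n >= 2.  Terms of a sequence are
   indexed from 0. *)

Definition Uset (n : nat) : {set 'Z_n} := [set u | u \is a GRing.unit].

Definition odd_elt (n : nat) (x : 'Z_n) : Prop :=
  exists2 k : int, ~~ (2 %| k)%Z & x = k%:~R.

(* Quantifying over indices rather than values counts terms with multiplicity. *)
Definition exactly_one_odd_term (n : nat) (S : seq 'Z_n) : Prop :=
  exists! i : 'I_(size S), odd_elt S`_i.

Definition weighted_zero_sum (n : nat) (A : {set 'Z_n}) (S : seq 'Z_n)
    (I : {set 'I_(size S)}) : Prop :=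
  I != set0 /\
  exists2 a : 'I_(size S) -> 'Z_n,
    forall i, i \in I -> a i \in A & \sum_(i in I) a i * S`_i = 0.

Definition has_weighted_zero_sum_of_length (n : nat) (A : {set 'Z_n})
    (l : nat) (S : seq 'Z_n) : Prop :=
  exists2 I : {set 'I_(size S)}, #|I| = l & weighted_zero_sum A I.

Definition gao_property (n : nat) (A : {set 'Z_n}) (k : nat) : Prop :=
  forall S : seq 'Z_n, size S = k -> has_weighted_zero_sum_of_length A n S.

(* The relation "k = E_A(n)". *)
Definition is_gao_constant (n : nat) (A : {set 'Z_n}) (k : nat) : Prop :=
  [/\ (0 < k)%N, gao_property A k
    & forall j : nat, (0 < j)%N -> gao_property A j -> (k <= j)%N].

Definition gao_extremal (n : nat) (A : {set 'Z_n}) (S : seq 'Z_n) : Prop :=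
  exists2 k : nat, is_gao_constant A k
    & size S = (k - 1)%N /\ ~ has_weighted_zero_sum_of_length A n S.

Definition weight_equiv (n : nat) (A : {set 'Z_n}) (X Y : seq 'Z_n) : Prop :=
  size X = size Y /\
  exists (c : 'Z_n) (s : {perm 'I_(size X)}) (a : 'I_(size X) -> 'Z_n),
    [/\ c \in Uset n, forall i, a i \in A
      & forall i, c * Y`_(s i) = a i * X`_i].

(* (b_0, q_0 b_1, q_0 q_1 b_2, ..., q_0 ... q_(k-2) b_(k-1)); only the values
   of q and b at indices below k matter. *)
Definition chain (n : nat) (q : nat -> nat) (b : nat -> int) (k : nat) :
    seq 'Z_n :=
  mkseq (fun i => (((\prod_(j < i) q j)%N)%:Z * b i)%:~R) k.

Definition form_star (n r : nat) (T : seq 'Z_n) : Prop :=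
  exists (q : nat -> nat) (b : nat -> int),
    [/\ forall i, (i < r.+1)%N -> prime (q i),
        n = (\prod_(i < r.+1) q i)%N,
        forall i, (i < r.+1)%N -> coprimez (b i) (q i)%:Z
      & T = chain n q b r.+1 ++ nseq (n - 1) 0].

Definition form_ast (n r : nat) (T : seq 'Z_n) : Prop :=
  exists (q : nat -> nat) (b : nat -> int) (m : nat),
    [/\ forall i, (i < r)%N -> prime (q i),
        n = (2 * \prod_(i < r) q i)%N,
        forall i, (i < r)%N -> coprimez (b i) (q i)%:Z,
        odd m && (1 <= m <= n)%N
      & T = chain n q b r ++ nseq m (n %/ 2)%:R ++ nseq (n - m) 0].

Definition form_ast_ast (n r : nat) (T : seq 'Z_n) : Prop :=
  exists (a : nat -> int) (c : int),
    [/\ forall i, (i < r - 1)%N -> ~~ (2 %| a i)%Z,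
        (2 ^+ r %| c)%Z
      & T = mkseq (fun i => (2 ^+ i * a i)%:~R) (r - 1)
            ++ [:: c%:~R; 2 ^+ (r - 1)] ++ nseq (n - 1) (n %/ 2)%:R].

(* Main.v *)
Require Import Defs.
From mathcomp Require Import all_boot all_order all_algebra all_fingroup.
From mathcomp Require Import cyclic zify.
Set Implicit Arguments.
Unset Strict Implicit.
Unset Printing Implicit Defensive.
Import GRing.Theory.

(** By the Chinese remainder theorem, whether a subsequence has a
U(n)-weighted zero sum depends only on the 2-adic valuation (capped at r) of
each term and on whether p divides it: modulo 2^r the condition is that the
terms of least valuation v < r are even in number, modulo p it is that the
number of terms prime to p is not 1.  A sequence of length n + r without a
zero-sum subsequence of length n is then peeled level by level.  A level with no
term would leave room for a zero sum; a level with a single term can only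
discard that term; and if the lowest level has at least two terms while at
least two terms are prime to p, a zero sum exists except at the last level,
where the exception is the end of the form ( ** ).  If only one term is prime
to p, discarding it leaves a problem modulo 2^r alone, which ends in the form
( * ).  Conversely, the initial terms of each form are useless: in turn, each is
the only remaining term of least valuation, or the only one prime to p; what
remains after discarding them is too short or has the wrong parity. *)

(** * Sums with coprime weights *)

(* [s] is the part of the weighted sum already formed. *)
Fixpoint reach (m : nat) (Y : seq nat) (s : nat) : Prop :=
  if Y is y :: Y' then exists2 a, coprime m a & reach m Y' (s + a * y)
  else m %| s.

Lemma reach_dvdn m m' Y s : m' %| m -> reach m Y s -> reach m' Y s.
Proof.
move=> dm; elim: Y s => [|y Y IH] s /=; first exact: dvdn_trans.
by case=> a ca /IH rY; exists a => //; apply: coprime_dvdl ca.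
Qed.

Lemma reach_ones m Y s : m %| s + sumn Y -> reach m Y s.
Proof.
elim: Y s => [|y Y IH] s /=; first by rewrite addn0.
by move=> h; exists 1; rewrite ?coprimen1 // mul1n; apply: IH; rewrite -addnA.
Qed.

Lemma dvdn_sumn d Y : all (dvdn d) Y -> d %| sumn Y.
Proof. by elim: Y => //= y Y IH /andP[dy /IH dY]; rewrite dvdn_add. Qed.

(** Weights chosen separately modulo [m1] and [m2] are glued by the Chinese remainder theorem. The
    three partial sums evolve differently, so only congruences tie them. *)
Lemma reach_mul m1 m2 Y s s1 s2 : coprime m1 m2 ->
    s = s1 %[mod m1] -> s = s2 %[mod m2] ->
  reach m1 Y s1 -> reach m2 Y s2 -> reach (m1 * m2) Y s.
Proof.
move=> co12; elim: Y s s1 s2 => [|y Y IH] s s1 s2 /= e1 e2.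
  by move=> d1 d2; rewrite Gauss_dvd // /dvdn e1 e2; apply/andP.
move=> [a ca ra] [b cb rb].
set c := chinese m1 m2 a b.
have ea : c = a %[mod m1] by apply: chinese_modl.
have eb : c = b %[mod m2] by apply: chinese_modr.
exists c.
  by rewrite coprimeMl -coprime_modr ea -(coprime_modr m2) eb !coprime_modr ca.
apply: IH ra rb.
  by rewrite -modnDm e1 -modnMml ea modnMml modnDm.
by rewrite -modnDm e2 -modnMml eb modnMml modnDm.
Qed.

(** The weight is [- s / y] modulo [m], written in [nat]: [m.-1] stands for -1, and Euler's theorem
    makes [y ^ (totient m).-1] an inverse of [y]. *)
Lemma coprime_solve m y s : 1 < m -> coprime m y -> coprime m s ->
  exists2 a, coprime m a & m %| s + a * y.
Proof.
move=> m1 cy cs; have m0 := ltnW m1.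
have t0 : 0 < totient m by rewrite totient_gt0.
exists (s * m.-1 * y ^ (totient m).-1).
  rewrite !coprimeMr cs coprimeXr // andbT /=.
  by rewrite -{1}(prednK m0) coprimeSn.
rewrite -mulnA -expnSr prednK // /dvdn -modnDmr -modnMmr Euler_exp_totient 1?coprime_sym //.
by rewrite modnMmr muln1 modnDmr -{1}(muln1 s) -mulnDr add1n prednK // modnMl.
Qed.

Lemma reach_prime_nec p Y s : prime p -> reach p Y s ->
  (count (fun y => ~~ (p %| y)) Y = 0 -> p %| s) /\
  (count (fun y => ~~ (p %| y)) Y = 1 -> ~~ (p %| s)).
Proof.
move=> pp; elim: Y s => [|y Y IH] s //= [a ca /IH [h0 h1]].
have ca' : p %| a = false by apply/negbTE; rewrite -prime_coprime.
case: (boolP (p %| y)) => py /=.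
  rewrite !add0n; split=> hc.
    by have := h0 hc; rewrite dvdn_addl // dvdn_mull.
  by have := h1 hc; rewrite dvdn_addl // dvdn_mull.
split=> // - [/h0]; case: (boolP (p %| s)) => // ps.
by rewrite dvdn_addr // Euclid_dvdM // ca' (negbTE py).
Qed.

(** Since [p] is odd, 1 and 2 are both admissible weights, and one of them keeps the partial sum
    nonzero modulo [p] until the last term prime to [p], whose weight then solves the congruence. *)
Lemma reach_prime_suff p Y s : prime p -> odd p ->
  (count (fun y => ~~ (p %| y)) Y = 0 -> p %| s) ->
  (count (fun y => ~~ (p %| y)) Y = 1 -> ~~ (p %| s)) ->
  reach p Y s.
Proof.
move=> pp op; have p1 := prime_gt1 pp.
have p2 : 2 < p by case: p pp op p1 => [|[|[|p]]].
elim: Y s => [|y Y IH] s /=; first by move=> h _; apply: h.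
case: (boolP (p %| y)) => py /=.
  rewrite !add0n => h0 h1; exists 1; first exact: coprimen1.
  by apply: IH; rewrite mul1n dvdn_addl.
rewrite !add1n => _.
case: (posnP (count (fun y => ~~ (p %| y)) Y)) => [c0 h1|cpos _].
  have cy : coprime p y by rewrite prime_coprime.
  have cs : coprime p s by rewrite prime_coprime // h1 ?c0.
  have [a ca da] := coprime_solve p1 cy cs.
  by exists a => //; apply: IH; rewrite ?c0.
have [d|d] := boolP (p %| s + 1 * y); last first.
  by exists 1; [exact: coprimen1 | apply: IH => // e0; rewrite e0 in cpos].
(* Weight 1 would make the partial sum vanish; weight 2 adds one more [y], which [p] does not
   divide. *)
exists 2; first by rewrite prime_coprime // gtnNdvd.
apply: IH => [e0|_]; first by rewrite e0 in cpos.
by move: d; rewrite mul1n mulSn mul1n addnA => d; rewrite dvdn_addr.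
Qed.

(** Weights are odd, so after division by [2 ^ k] the parity of the sum counts the terms of
    valuation exactly [k]. *)
Lemma reach_pow2_nec r k Y w : k < r -> all (fun y => 2 ^ k %| y) Y ->
  reach (2 ^ r) Y (2 ^ k * w) ->
  odd w = odd (count (fun y => ~~ (2 ^ k.+1 %| y)) Y).
Proof.
move=> kr; elim: Y w => [|y Y IH] w /=.
  move=> _ h; have : 2 ^ k.+1 %| 2 ^ k * w by apply: dvdn_trans h; rewrite dvdn_exp2l.
  by rewrite expnSr dvdn_pmul2l ?expn_gt0 // dvdn2 => /negbTE.
move=> /andP[/dvdnP[z ->] hY] [a ca].
rewrite (mulnC z) mulnCA -mulnDr => /(IH _ hY).
rewrite expnSr dvdn_pmul2l ?expn_gt0 // dvdn2 negbK !oddD oddM.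
have -> : odd a.
  by rewrite -coprime2n; apply: coprime_dvdl ca; rewrite dvdn_exp // (leq_trans _ kr).
by rewrite /= oddb => <-; rewrite addbC addbK.
Qed.

(** All weights are 1 except that of the last term of valuation exactly [k]; the parity hypothesis
    makes the congruence for this weight solvable. *)
Lemma reach_pow2_suff r k Y w : k < r -> all (fun y => 2 ^ k %| y) Y ->
  has (fun y => ~~ (2 ^ k.+1 %| y)) Y ->
  odd w = odd (count (fun y => ~~ (2 ^ k.+1 %| y)) Y) ->
  reach (2 ^ r) Y (2 ^ k * w).
Proof.
move=> kr; have r1 : 1 < 2 ^ r by rewrite -{1}(expn0 2) ltn_exp2l // (leq_trans _ kr).
have d2 z : 2 ^ k.+1 %| 2 ^ k * z = ~~ odd z.
  by rewrite expnSr dvdn_pmul2l ?expn_gt0 // dvdn2.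
have co z : odd z -> coprime (2 ^ r) z by move=> oz; rewrite coprimeXl // coprime2n.
elim: Y w => [|y Y IH] w //= /andP[/dvdnP[z ->] hY].
rewrite (mulnC z) d2 negbK oddD oddb.
have [hasY _ ow|/hasPn nY] := boolP (has (fun y => ~~ (2 ^ k.+1 %| y)) Y).
  exists 1; first exact: coprimen1.
  rewrite mul1n -mulnDr; apply: IH => //.
  by rewrite oddD ow addbC addKb.
have c0 : count (fun y => ~~ (2 ^ k.+1 %| y)) Y = 0.
  by apply/eqP; rewrite -leqn0 leqNgt -has_count; apply/hasPn.
rewrite orbF c0 addbF => oz; rewrite oz => ow.
(* The terms after the last odd multiple of [2 ^ k] get weight 1 and join the constant before the
   weight is solved for. *)
have [t et] : exists t, sumn Y = 2 ^ k * (2 * t).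
  have : 2 ^ k.+1 %| sumn Y.
    by apply/dvdn_sumn/allP=> x /nY /negPn.
  by case/dvdnP=> t ->; exists t; rewrite expnSr; lia.
have ot : odd (w + 2 * t) by rewrite oddD ow oddM.
have [a ca da] := coprime_solve r1 (co _ oz) (co _ ot).
exists a => //.
apply: reach_ones; rewrite et.
have -> : 2 ^ k * w + a * (2 ^ k * z) + 2 ^ k * (2 * t) = 2 ^ k * (w + 2 * t + a * z) by lia.
exact: dvdn_mull.
Qed.

Lemma reach_pow2 r Y :
  reach (2 ^ r) Y 0 <->
  (forall k, k < r -> all (fun y => 2 ^ k %| y) Y ->
     ~~ odd (count (fun y => ~~ (2 ^ k.+1 %| y)) Y)).
Proof.
split=> [rY k kr aY|h].
  by rewrite -(reach_pow2_nec (w := 0) kr aY) ?muln0.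
(* [k] is the least valuation that occurs, or [r] if every term is divisible by [2 ^ r]. *)
have [k [kr ak /orP[nk|/eqP ek]]] : exists k, [/\ k <= r, all (fun y => 2 ^ k %| y) Y &
    has (fun y => ~~ (2 ^ k.+1 %| y)) Y || (k == r)].
  elim: r {h} => [|r [k [kr ak /orP[nk|/eqP ek]]]].
  - by exists 0; rewrite orbT; split=> //; apply/allP=> y _; rewrite dvd1n.
  - by exists k; split; rewrite ?nk // ltnW.
  rewrite ek in ak; have [nr|/hasPn nr] := boolP (has (fun y => ~~ (2 ^ r.+1 %| y)) Y).
    by exists r; rewrite nr; split.
  exists r.+1; split; rewrite ?eqxx ?orbT //.
  by apply/allP=> y /nr /negPn.
- move: kr; rewrite leq_eqVlt => /orP[/eqP ek|kr]; last first.
    have := @reach_pow2_suff _ _ _ 0 kr ak nk; rewrite muln0; apply.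
    by rewrite (negbTE (h _ kr ak)).
  by rewrite ek in ak; apply: reach_ones; apply: dvdn_sumn.
by rewrite ek in ak; apply: reach_ones; apply: dvdn_sumn.
Qed.

Lemma reach_prime p Y : prime p -> odd p ->
  reach p Y 0 <-> count (fun y => ~~ (p %| y)) Y != 1.
Proof.
move=> pp op; split=> [rY|n1].
  by apply/eqP=> /(reach_prime_nec pp rY).2; rewrite dvdn0.
by apply: reach_prime_suff => [||_|] //; move=> e1; rewrite e1 in n1.
Qed.

Lemma reach_pow2_prime r p Y : prime p -> odd p ->
  reach (2 ^ r * p) Y 0 <-> reach (2 ^ r) Y 0 /\ reach p Y 0.
Proof.
move=> pp op; split=> [h|[h1 h2]].
  by split; apply: (reach_dvdn _ h); [apply: dvdn_mulr | apply: dvdn_mull].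
by apply: (reach_mul _ _ _ h1 h2); rewrite ?coprimeXl ?coprime2n.
Qed.

(** * Marked multisets with levels *)

Definition has_sub (T : eqType) (P : seq T -> Prop) (L : nat) (X : seq T) : Prop :=
  exists Y Z, [/\ perm_eq X (Y ++ Z), size Y = L & P Y].

(** Below the least level of [X] the count is zero, and above it the premise on [all] fails; so only
    the least level is constrained, and only if it is below [r]. *)
Definition even_levels (T : eqType) (v : T -> nat) (r : nat) (X : seq T) : Prop :=
  forall k, k < r -> all (fun x => k <= v x) X ->
    ~~ odd (count (fun x => v x == k) X).

Definition good (T : eqType) (v : T -> nat) (e : pred T) (r : nat) (X : seq T) :=
  even_levels v r X /\ count e X != 1.

Lemma has_sub_perm (T : eqType) P L (X X' : seq T) :
  perm_eq X X' -> has_sub P L X' -> has_sub P L X.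
Proof.
move=> pX [Y [Z [pY sY PY]]]; exists Y, Z; split=> //.
exact: perm_trans pX pY.
Qed.

Lemma has_sub_catl (T : eqType) P L (X W : seq T) :
  has_sub P L X -> has_sub P L (W ++ X).
Proof.
move=> [Y [Z [pY sY PY]]]; exists Y, (W ++ Z); split=> //.
by apply: perm_trans (perm_cat (perm_refl W) pY) _; rewrite perm_catCA.
Qed.

Lemma has_sub_impl (T : eqType) (P Q : seq T -> Prop) L (X : seq T) :
    (forall Y Z, perm_eq X (Y ++ Z) -> P Y -> Q Y) ->
  has_sub P L X -> has_sub Q L X.
Proof. by move=> PQ [Y [Z [pY sY PY]]]; exists Y, Z; split=> //; apply: PQ pY PY. Qed.

Lemma perm_cat_sub (T : eqType) (P Q Y Y' Z Z' : seq T) :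
    perm_eq P (Y ++ Z) -> perm_eq Q (Y' ++ Z') ->
  perm_eq (P ++ Q) ((Y ++ Y') ++ (Z ++ Z')).
Proof. by move=> pP pQ; apply: perm_trans (perm_cat pP pQ) _; rewrite perm_catACA. Qed.

Lemma perm_take_drop (T : eqType) k (P : seq T) : perm_eq P (take k P ++ drop k P).
Proof. by rewrite cat_take_drop. Qed.

Lemma count_take_all (T : eqType) (a : pred T) k P :
  all a P -> k <= size P -> count a (take k P) = k.
Proof.
move=> aP kP; have := all_count a (take k P); rewrite size_takel // => e.
by apply/eqP; rewrite -e; apply/allP=> x /mem_take; apply/allP.
Qed.

Lemma count_take_none (T : eqType) (a : pred T) k P :
  all (predC a) P -> count a (take k P) = 0.
Proof.
move=> aP; apply/eqP; rewrite -leqn0 leqNgt -has_count -all_predC.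
by apply/allP=> x /mem_take; apply/allP.
Qed.

Lemma split_level (T : eqType) (v : T -> nat) s X : all (fun x => s <= v x) X ->
  exists P Q, [/\ perm_eq X (P ++ Q), size P = count (fun x => v x == s) X,
    all (fun x => v x == s) P & all (fun x => s < v x) Q].
Proof.
move=> sX; exists (filter (fun x => v x == s) X), (filter (predC (fun x => v x == s)) X).
split; rewrite ?size_filter ?filter_all //; first by rewrite perm_sym perm_filterC.
apply/allP=> x; rewrite mem_filter /= => /andP[nx xX].
by rewrite ltn_neqAle eq_sym nx (allP sX).
Qed.

Lemma even_levels_top (T : eqType) (v : T -> nat) r s Y : r <= s ->
  all (fun x => s <= v x) Y -> even_levels v r Y.
Proof.
move=> rs sY k kr _; rewrite (_ : count _ _ = 0) //.
apply/eqP; rewrite -leqn0 leqNgt -has_count; apply/hasPn=> x /(allP sY) sx.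
by rewrite neq_ltn (leq_trans kr (leq_trans rs sx)) orbT.
Qed.

(** Levels below [s] are empty; a level above [s] is either ruled out by a term at level [s] or not
    below [r]. *)
Lemma even_levels_at (T : eqType) (v : T -> nat) r s Y :
    all (fun x => s <= v x) Y -> ~~ odd (count (fun x => v x == s) Y) ->
    has (fun x => v x == s) Y || (r <= s.+1) ->
  even_levels v r Y.
Proof.
move=> sY ev h k kr aY; case: (ltngtP k s) => [ks|sk|-> //].
  by apply: (even_levels_top (leqnn s) sY ks aY).
case/orP: h => [/hasP[x xY /eqP vx]|]; last by move: kr sk; lia.
by move: (allP aY _ xY); rewrite vx leqNgt sk.
Qed.

(** An even number of lowest terms, as large as fits, is completed by higher terms; the surplus term
    pays for the one that an odd level leaves out. *)
Lemma even_sub_step (T : eqType) (v : T -> nat) r s L X : ~~ odd L -> 0 < L ->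
    all (fun x => s <= v x) X -> 2 <= count (fun x => v x == s) X ->
    L < size X ->
  has_sub (even_levels v r) L X.
Proof.
move=> oL L0 sX c2 LX; have [P [Q [pX sP aP aQ]]] := split_level sX; rewrite -sP in c2.
have sz : size X = size P + size Q by rewrite (perm_size pX) size_cat.
pose k := minn L (size P)./2.*2.
have [kP kL k0 kev] : [/\ k <= size P, k <= L, 0 < k & ~~ odd k].
  by move: (odd_double_half (size P)); rewrite /k; split; move: oL; lia.
have LkQ : L - k <= size Q.
  by move: (odd_double_half (size P)) LX oL; rewrite sz /k; lia.
have pY := perm_cat_sub (perm_take_drop k P) (perm_take_drop (L - k) Q).
have cY : count (fun x => v x == s) (take k P ++ take (L - k) Q) = k.
  rewrite count_cat count_take_all // count_take_none ?addn0 //.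
  by apply: sub_all aQ => x /= sx; rewrite neq_ltn sx orbT.
exists (take k P ++ take (L - k) Q), (drop k P ++ drop (L - k) Q); split.
- exact: perm_trans pX pY.
- by rewrite size_cat !size_takel //; lia.
apply: (@even_levels_at _ _ _ s).
- rewrite (perm_all _ (perm_trans pX pY)) all_cat in sX.
  by case/andP: sX.
- by rewrite cY.
- by rewrite has_count cY k0.
Qed.

Lemma all_perm_cat (T : eqType) (a : pred T) X Y Z :
  perm_eq X (Y ++ Z) -> all a X -> all a Y /\ all a Z.
Proof. by move=> pX; rewrite (perm_all _ pX) all_cat => /andP. Qed.

(** A lowest level with at most one term is discarded, which costs at most one unit of the surplus
    [m] and removes one level; after [m] levels nothing is left to check. *)
Lemma has_even_sub (T : eqType) (v : T -> nat) m s L X : ~~ odd L -> 0 < L ->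
    all (fun x => s <= v x) X -> L + m <= size X ->
  has_sub (even_levels v (s + m)) L X.
Proof.
move=> oL L0; elim: m s X => [|m IH] s X sX LX.
  rewrite addn0; rewrite addn0 in LX.
  exists (take L X), (drop L X); split; rewrite ?size_takel ?cat_take_drop //.
  by have [tX _] := all_perm_cat (perm_take_drop L X) sX; apply: even_levels_top tX.
have [c2|c1] := leqP 2 (count (fun x => v x == s) X).
  by apply: even_sub_step sX c2 _ => //; lia.
have [P [Q [pX sP aP aQ]]] := split_level sX.
apply: (has_sub_perm pX); apply: has_sub_catl.
rewrite addnS -addSn; apply: IH => //.
by move: LX; rewrite (perm_size pX) size_cat sP; lia.
Qed.

(* [p1], [p0] (resp. [q1], [q0]) count the terms at the lowest level (resp. above
   it) with and without the mark [e]; the target numbers those kept. *)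
Lemma choose_counts L d p1 p0 q1 q0 : ~~ odd L -> 4 <= L ->
    2 <= p1 + p0 -> 2 <= p1 + q1 -> p1 + p0 + (q1 + q0) = L + d.+1 ->
  (exists x1 x0 y1 y0,
    [/\ x1 <= p1, x0 <= p0, y1 <= q1 & y0 <= q0] /\
    [/\ x1 + x0 + (y1 + y0) = L, ~~ odd (x1 + x0), 0 < x1 + x0 & x1 + y1 != 1]) \/
  [/\ d = 0, p1 = 1, q1 = 1 & q0 = 0].
Proof.
move=> oL L4; elim: d p1 p0 q1 q0 => [|d IH] p1 p0 q1 q0 hp hq eL.
  have [op|op] := boolP (odd (p1 + p0)).
    case: (posnP p0) => [z|z].
      by left; exists p1.-1, p0, q1, q0; split; split; lia.
    by have [p2|p2] := leqP 3 (p1 + q1); [case: (posnP p1) => w |];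
     left; [exists p1, p0.-1, q1, q0 | exists p1.-1, p0, q1, q0 | exists p1, p0.-1, q1, q0]; split; split; lia.
  case: (posnP q0) => [z|z]; last by left; exists p1, p0, q1, q0.-1; split; split; lia.
  have [p2|p2] := leqP 3 (p1 + q1); first by left; exists p1, p0, q1.-1, q0; split; split; lia.
  by right; split; lia.
have step p1' p0' q1' q0' : p1' <= p1 -> p0' <= p0 -> q1' <= q1 -> q0' <= q0 ->
   2 <= p1' + p0' -> 2 <= p1' + q1' -> p1' + p0' + (q1' + q0') = L + d.+1 ->
   (d == 0) && (p1' == 1) && (q1' == 1) && (q0' == 0) = false ->
   exists x1 x0 y1 y0,
    [/\ x1 <= p1, x0 <= p0, y1 <= q1 & y0 <= q0] /\
    [/\ x1 + x0 + (y1 + y0) = L, ~~ odd (x1 + x0), 0 < x1 + x0 & x1 + y1 != 1].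
  move=> l1 l2 l3 l4 h1 h2 h3 ne; case: (IH _ _ _ _ h1 h2 h3) => [|[a b c g]].
    by case=> x1 [x0 [y1 [y0 [[? ? ? ?] h]]]]; exists x1, x0, y1, y0; split=> //; split; lia.
  by rewrite a b c g in ne.
left; case: (posnP q0) => [z|z]; last first.
  (* Where dropping a higher unmarked term would reach the exception, a lowest unmarked one goes
     instead. *)
  have [ex|ex] := boolP ((d == 0) && (p1 == 1) && (q1 == 1) && (q0.-1 == 0)).
    by apply: (step p1 p0.-1 q1 q0); lia.
  by apply: (step p1 p0 q1 q0.-1); lia.
(* In the first case [p0 = L], so the unmarked terms of the lowest level suffice. *)
have [ex|ex] := boolP ((d == 0) && (p1 == 1) && (q1 == 1)).
  by exists 0, L, 0, 0; split; split; lia.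
have [p3|p3] := leqP 3 (p1 + p0); last by apply: (step p1 p0 q1.-1 q0); lia.
case: (posnP p0) => [w|w].
  case: (posnP q1) => u; first by apply: (step p1.-1 p0 q1 q0); lia.
  by apply: (step p1 p0 q1.-1 q0); lia.
by apply: (step p1 p0.-1 q1 q0); lia.
Qed.

Lemma split_pred (T : eqType) (e : pred T) X :
  exists P Q, [/\ perm_eq X (P ++ Q), size P = count e X, all e P & all (predC e) Q].
Proof.
exists (filter e X), (filter (predC e) X).
by split; rewrite ?size_filter ?filter_all //; rewrite perm_sym perm_filterC.
Qed.

(** Once some term at level [s] is kept, goodness depends only on how many terms come from each of
    four classes: marked or not, at level [s] or above. So [choose_counts] decides, and its
    exception is the tail in [shape_ast_ast]. *)
Lemma good_sub_step (T : eqType) (v : T -> nat) (e : pred T) r s L X :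
    ~~ odd L -> 4 <= L -> all (fun x => s <= v x) X ->
    2 <= count (fun x => v x == s) X -> 2 <= count e X -> L < size X ->
  has_sub (good v e r) L X \/
  size X = L.+1 /\ exists c d M, [/\ perm_eq X [:: c, d & M], s < v c, v d = s /\ e d
    & all (fun x => (v x == s) && ~~ e x) M].
Proof.
move=> oL L4 sX c2 e2 LX.
have [P [Q [pX sP aP aQ]]] := split_level sX.
have [P1 [P0 [pP sP1 eP1 eP0]]] := split_pred e P.
have [Q1 [Q0 [pQ sQ1 eQ1 eQ0]]] := split_pred e Q.
have [aP1 aP0] := all_perm_cat pP aP; have [aQ1 aQ0] := all_perm_cat pQ aQ.
have eX : count e X = size P1 + size Q1.
  by rewrite (seq.permP pX) count_cat sP1 sQ1.
have szP : size P = size P1 + size P0 by rewrite (perm_size pP) size_cat.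
have szX : size X = size P1 + size P0 + (size Q1 + size Q0).
  by rewrite (perm_size (perm_trans pX (perm_cat pP pQ))) !size_cat.
have pX4 := perm_trans pX (perm_cat pP pQ).
have szd : size X = L + (size X - L).-1.+1.
  by rewrite prednK ?subn_gt0 // subnKC // ltnW.
have c2' : 2 <= size P1 + size P0 by rewrite -szP sP.
rewrite eX in e2; rewrite szX in szd.
case: (choose_counts oL L4 c2' e2 szd).
  move=> [x1 [x0 [y1 [y0 [[h1 h0 k1 k0] [hL hodd hpos he]]]]]]; left.
  have nQ R : all (fun x => s < v x) R -> all (predC (fun x => v x == s)) R.
    by apply: sub_all => x /= sx; rewrite neq_ltn sx orbT.
  pose Y := (take x1 P1 ++ take x0 P0) ++ (take y1 Q1 ++ take y0 Q0).
  have [Z pY] : exists Z, perm_eq X (Y ++ Z).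
    by eexists; apply: perm_trans pX4 _; apply: perm_cat_sub;
      apply: perm_cat_sub; apply: perm_take_drop.
  have cY : count (fun x => v x == s) Y = x1 + x0.
    by rewrite !count_cat !(count_take_all aP1, count_take_all aP0) //
      !(count_take_none _ (nQ _ aQ1), count_take_none _ (nQ _ aQ0)) // !addn0.
  exists Y, Z; split=> //; first by rewrite !size_cat !size_takel.
  split.
    apply: (@even_levels_at _ _ _ s); rewrite ?cY //; last by rewrite has_count cY hpos.
    by case: (all_perm_cat pY sX).
  rewrite !count_cat (count_take_all eP1) // (count_take_none _ eP0).
  by rewrite (count_take_all eQ1) // (count_take_none _ eQ0) !addn0.
move=> [d0 /eqP p1 /eqP q1 /eqP q0]; right; split; first by move: szX szd; rewrite d0 addn1 => -> ->.
have sz1 (R : seq T) : size R == 1 -> exists d, R = [:: d].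
  by case: R => [|d [|? ?]] // _; exists d.
have [d eP1d] := sz1 _ p1; have [c eQ1c] := sz1 _ q1.
move/nilP: q0 => q0; rewrite q0 eP1d eQ1c in pX4 eP1 aP1 aQ1.
move: eP1 aP1 aQ1; rewrite /= !andbT => ed /eqP vd vc.
exists c, d, P0; split=> //; last first.
  by apply/allP=> x xP; rewrite (allP aP0) //=; exact: (allP eP0).
by apply: perm_trans pX4 _; rewrite cats0 perm_catC.
Qed.

Lemma count0_all (T : eqType) (a : pred T) X : count a X = 0 -> all (predC a) X.
Proof. by rewrite all_predC has_count => ->. Qed.

Lemma has_good_sub_unmarked (T : eqType) (v : T -> nat) (e : pred T) m s L X :
    ~~ odd L -> 0 < L -> all (fun x => s <= v x) X -> count e X = 0 ->
    L + m <= size X ->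
  has_sub (good v e (s + m)) L X.
Proof.
move=> oL L0 sX eX LX; apply: has_sub_impl (has_even_sub oL L0 sX LX).
move=> Y Z pX lY; split=> //; move: eX.
by rewrite (seq.permP pX) count_cat; lia.
Qed.

Lemma perm_mark (T : eqType) (e : pred T) X : count e X = 1 ->
  exists x X', [/\ perm_eq X (x :: X'), e x & count e X' = 0].
Proof.
move=> eX; have [P [Q [pX sP eP eQ]]] := split_pred e X.
case: P sP pX eP => [|x [|? ?]]; rewrite eX //= => _ pX /andP[ex _].
by exists x, Q; split=> //; move: eX; rewrite (seq.permP pX) /= ex => -[].
Qed.

(** A single marked term is discarded first, which is why the size bound is strict. *)
Lemma has_good_sub_mark1 (T : eqType) (v : T -> nat) (e : pred T) m s L X :
    ~~ odd L -> 0 < L -> all (fun x => s <= v x) X -> count e X <= 1 ->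
    L + m < size X ->
  has_sub (good v e (s + m)) L X.
Proof.
move=> oL L0 sX e1 LX; have [e0|e01] := posnP (count e X).
  by apply: has_good_sub_unmarked => //; lia.
have e01' : count e X = 1 by lia.
have [x [X' [pX ex eX']]] := perm_mark e01'.
move: sX LX; rewrite (perm_all _ pX) (perm_size pX) /= => /andP[_ sX'] LX.
apply: (has_sub_perm pX); apply: (has_sub_catl [:: x]).
by apply: has_good_sub_unmarked => //; lia.
Qed.

Lemma perm_level (T : eqType) (v : T -> nat) s X : all (fun x => s <= v x) X ->
  count (fun x => v x == s) X = 1 ->
  exists x X', [/\ perm_eq X (x :: X'), v x = s & all (fun x => s < v x) X'].
Proof.
move=> sX cX; have [P [Q [pX sP aP aQ]]] := split_level sX.
case: P sP pX aP => [|x [|? ?]]; rewrite cX //= => _ pX /andP[/eqP vx _].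
by exists x, Q.
Qed.

Lemma all_level (T : eqType) (v : T -> nat) s X : all (fun x => s <= v x) X ->
  count (fun x => v x == s) X = 0 -> all (fun x => s < v x) X.
Proof.
move=> /allP sX /count0_all/allP nX; apply/allP=> x xX.
by rewrite ltn_neqAle eq_sym (nX x xX : v x != s) sX.
Qed.

Lemma has_good_sub (T : eqType) (v : T -> nat) (e : pred T) m s L X :
    ~~ odd L -> 4 <= L -> all (fun x => s <= v x) X -> L + m < size X ->
  has_sub (good v e (s + m)) L X.
Proof.
move=> oL L4; have L0 : 0 < L by lia.
elim: m s X => [|m IH] s X sX LX.
  have [e1|e2] := leqP (count e X) 1.
    by apply: has_good_sub_mark1 => //; lia.
  (* No level is left to constrain, and listing marked terms first keeps all of them or [L] of them,
     never exactly one. *)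
  have [P [Q [pX sP eP eQ]]] := split_pred e X.
  have pX' := perm_trans pX (perm_take_drop L (P ++ Q)).
  exists (take L (P ++ Q)), (drop L (P ++ Q)); split=> //.
    by rewrite size_takel // -(perm_size pX); lia.
  split; first by case: (all_perm_cat pX' sX) => tX _; apply: even_levels_top tX; rewrite addn0.
  rewrite take_cat; case: ltnP => [cL|_].
    by rewrite count_take_all ?(ltnW cL) //; lia.
  rewrite all_count in eP; rewrite count_cat (eqP eP) sP; move: e2; clear; lia.
have [c2|c1] := leqP 2 (count (fun x => v x == s) X).
  have [e2|e1] := leqP 2 (count e X).
    by case: (good_sub_step (s + m.+1) oL L4 sX c2 e2 _) => [||[]] //; lia.
  by apply: has_good_sub_mark1 => //; lia.
have [P [Q [pX sP aP aQ]]] := split_level sX.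
apply: (has_sub_perm pX); apply: has_sub_catl.
rewrite addnS -addSn; apply: IH => //.
by move: LX; rewrite (perm_size pX) size_cat sP; lia.
Qed.

(** * Multisets without a good sub-multiset *)

(** Each level below [s + m] holds exactly one term: an empty one would restore the surplus needed
    by [has_even_sub], and two terms suffice for [even_sub_step]. Exactly [L] terms then remain,
    hence the odd count at level [s + m]. *)
Lemma no_even_sub (T : eqType) (v : T -> nat) m s L X : ~~ odd L -> 0 < L ->
    all (fun x => s <= v x) X -> size X = L + m ->
    ~ has_sub (even_levels v (s + m.+1)) L X ->
  exists B M Z, [/\ perm_eq X (B ++ M ++ Z), map v B = iota s m,
    all (fun x => v x == s + m) M, odd (size M) & all (fun x => s + m < v x) Z].
Proof.
move=> oL L0; elim: m s X => [|m IH] s X sX szX nX.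
  have [P [Q [pX sP aP aQ]]] := split_level sX.
  exists [::], P, Q; rewrite addn0; split=> //.
  apply/negPn/negP; rewrite sP => ev; apply: nX.
  exists X, [::]; rewrite cats0 szX addn0 addn1; split=> //.
  by apply: even_levels_at sX ev _; rewrite leqnn orbT.
case c0: (count (fun x => v x == s) X) => [|[|c]].
- case: nX; rewrite addnS -addSn; apply: has_even_sub => //; last by rewrite szX.
  exact: all_level.
- have [x [X' [pX vx aX']]] := perm_level sX c0.
  have [|nX'|B [M [Z [pX' vB vM oM vZ]]]] := IH s.+1 X' aX'.
  + by move: szX; rewrite (perm_size pX) /= addnS => -[].
  + by apply: nX; rewrite addnS -addSn; apply: (has_sub_perm pX (has_sub_catl [:: x] nX')).
  exists (x :: B), M, Z; rewrite addnS -addSn /= vx vB; split=> //.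
  by rewrite (perm_trans pX) // perm_cons.
by case: nX; apply: even_sub_step sX _ _; rewrite ?c0 // szX addnS ltnS leq_addr.
Qed.

(* The three shapes below are the types of the forms (star), (ast) and (ast ast),
   with the levels starting at [s] and ending at [s + m]. *)
Definition shape_star (T : eqType) (v : T -> nat) (e : pred T) s m (X : seq T) :=
  exists A d Z, [/\ perm_eq X (A ++ d :: Z), map v A = iota s m.+1,
    e d, s + m < v d & all (fun x => (s + m < v x) && ~~ e x) Z].

Definition shape_ast (T : eqType) (v : T -> nat) (e : pred T) s m (X : seq T) :=
  exists j A d B M Z,
  [/\ perm_eq X (A ++ d :: B ++ M ++ Z), j <= m, map v A = iota s j, e d & s + j <= v d] /\
  [/\ map v B = iota (s + j) (m - j), all (predC e) B,
      all (fun x => (v x == s + m) && ~~ e x) M, odd (size M)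
    & all (fun x => (s + m < v x) && ~~ e x) Z].

Definition shape_ast_ast (T : eqType) (v : T -> nat) (e : pred T) s m (X : seq T) :=
  exists A c d M, [/\ perm_eq X (A ++ [:: c, d & M]), map v A = iota s m,
    s + m < v c, v d = s + m /\ e d & all (fun x => (v x == s + m) && ~~ e x) M].

Lemma all_predI2 (T : eqType) (a e : pred T) X :
  all a X -> count e X = 0 -> all (fun x => a x && ~~ e x) X.
Proof.
by move=> /allP aX /count0_all/allP eX; apply/allP=> x xX; rewrite aX //=; apply: eX.
Qed.

(** A sub-multiset avoiding the marked term has no mark at all, so the other terms satisfy the
    hypothesis of [no_even_sub]. *)
Lemma no_good_sub_mark1 (T : eqType) (v : T -> nat) (e : pred T) m s L X :
    ~~ odd L -> 0 < L -> all (fun x => s <= v x) X -> size X = L + m.+1 ->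
    count e X = 1 -> ~ has_sub (good v e (s + m.+1)) L X ->
  shape_ast v e s m X.
Proof.
move=> oL L0 sX szX eX nX; have [d [X' [pX ed eX']]] := perm_mark eX.
move: sX szX; rewrite (perm_all _ pX) (perm_size pX) /= addnS => /andP[sd sX'] [szX'].
have [hX'|B [M [Z [pX' vB vM oM vZ]]]] := no_even_sub oL L0 sX' szX'.
  apply: nX; apply: (has_sub_perm pX); apply: (has_sub_catl [:: d]).
  apply: has_sub_impl hX' => Y W pY lY; split=> //.
  by move: eX'; rewrite (seq.permP pY) count_cat; case: (count e Y).
move: eX'; rewrite (seq.permP pX') !count_cat => /eqP.
rewrite !addn_eq0 => /and3P[/eqP eB /eqP eM /eqP eZ].
(* The marked term opens the chain; levels peeled earlier are prepended afterwards, each raising [j]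
   by one. *)
exists 0, [::], d, B, M, Z; rewrite addn0 subn0; split; split=> //.
- by apply: (perm_trans pX); rewrite perm_cons.
- exact: count0_all.
- exact: all_predI2.
- exact: all_predI2.
Qed.

(** Fewer than two marks are settled directly; an empty lowest level would leave enough surplus; and
    a lowest level with two terms leaves only the exception of [good_sub_step], whose size forces
    [m = 0]. *)
Lemma no_good_sub_step (T : eqType) (v : T -> nat) (e : pred T) m s L X :
    ~~ odd L -> 4 <= L -> all (fun x => s <= v x) X -> size X = L + m.+1 ->
    ~ has_sub (good v e (s + m.+1)) L X ->
  [\/ shape_ast v e s m X, shape_ast_ast v e s m X
    | exists x X', [/\ perm_eq X (x :: X'), v x = s & all (fun x => s < v x) X']].
Proof.
move=> oL L4 sX szX nX; have L0 : 0 < L by exact: leq_trans L4.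
have LX : L < size X by rewrite szX addnS ltnS leq_addr.
case e1: (count e X) => [|[|k]].
- by case: nX; apply: has_good_sub_unmarked; rewrite ?szX.
- by apply: Or31; apply: no_good_sub_mark1 e1 nX.
have e2 : 1 < count e X by rewrite e1.
have [c2|] := leqP 2 (count (fun x => v x == s) X).
  have [//|[szL [c [d [M [pX vc [vd ed] aM]]]]]] := good_sub_step (s + m.+1) oL L4 sX c2 e2 LX.
  move: szX; rewrite szL -addn1 => /addnI[m0].
  by apply: Or32; exists [::], c, d, M; rewrite -m0 addn0.
case c1: (count (fun x => v x == s) X) => [|[|//]] _.
  case: nX; rewrite addnS -addSn; apply: has_good_sub => //; last by rewrite szX addnS.
  exact: all_level.
by have [x [X' h]] := perm_level sX c1; apply: Or33; exists x, X'.
Qed.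

Lemma no_good_sub_shape (T : eqType) (v : T -> nat) (e : pred T) m s L X :
    ~~ odd L -> 4 <= L -> all (fun x => s <= v x) X -> size X = L + m.+1 ->
    ~ has_sub (good v e (s + m.+1)) L X ->
  [\/ shape_star v e s m X, shape_ast v e s m X | shape_ast_ast v e s m X].
Proof.
move=> oL L4; elim: m s X => [|m IH] s X sX szX nX;
  case: (no_good_sub_step oL L4 sX szX nX) => [h|h|[x [X' [pX vx aX']]]];
  try (by apply: Or32); try (by apply: Or33).
all: move: (szX); rewrite (perm_size pX) /= addnS => -[szX'].
  (* For [m = 0] all levels are now exhausted and exactly [L] terms remain, so only the mark
     condition can fail. *)
  have [e1|e1] := eqVneq (count e X') 1; last first.
    case: nX; apply: (has_sub_perm pX); apply: (has_sub_catl [:: x]).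
    exists X', [::]; rewrite cats0 szX' addn0; split=> //; split=> //.
    by apply: even_levels_top aX'; rewrite addn1.
  have [d [Z [pX' ed eZ]]] := perm_mark e1.
  move: aX'; rewrite (perm_all _ pX') /= => /andP[vd aZ].
  apply: Or31; exists [:: x], d, Z; rewrite addn0 /= vx; split=> //.
    by apply: (perm_trans pX); rewrite perm_cons.
  exact: all_predI2.
have nX' : ~ has_sub (good v e (s.+1 + m.+1)) L X'.
  by rewrite addSnnS => h; apply: nX; apply: (has_sub_perm pX (has_sub_catl [:: x] h)).
have addX A : perm_eq X' A -> perm_eq X (x :: A).
  by move=> pA; apply: (perm_trans pX); rewrite perm_cons.
case: (IH _ _ aX' szX' nX').
- move=> [A [d [Z [pA vA ed vd aZ]]]]; rewrite addSnnS in vd aZ.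
  by apply: Or31; exists (x :: A), d, Z; rewrite /= vA vx; split=> //; apply: (addX _ pA).
- move=> [j [A [d [B [M [Z [[pA jm vA ed vd] [vB eB aM oM aZ]]]]]]]].
  rewrite !addSnnS in vd vB aM aZ.
  apply: Or32; exists j.+1, (x :: A), d, B, M, Z; rewrite /= vA vx subSS.
  by split; split=> //; apply: (addX _ pA).
move=> [A [c [d [M [pA vA vc [vd ed] aM]]]]]; rewrite !addSnnS in vc vd aM.
by apply: Or33; exists (x :: A), c, d, M; rewrite /= vA vx; split=> //; apply: (addX _ pA).
Qed.

(** * Terms that no good sub-multiset contains *)

Lemma has_sub_behead (T : eqType) (P : seq T -> Prop) L x X :
    (forall Y Z, perm_eq (x :: X) (Y ++ Z) -> x \in Y -> ~ P Y) ->
  has_sub P L (x :: X) -> has_sub P L X.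
Proof.
move=> nP [Y [Z [pY sY PY]]].
have xY : x \notin Y by apply/negP=> xY; apply: nP pY xY PY.
have xZ : x \in Z by have := perm_mem pY x; rewrite mem_head mem_cat (negbTE xY).
exists Y, (rem x Z); split=> //; rewrite -(perm_cons x) (perm_trans pY) //.
rewrite -[X in perm_eq _ X]cat1s perm_sym perm_catCA perm_cat2l perm_sym.
exact: perm_to_rem.
Qed.

(** If chosen, [x] would be alone at the least level: an odd count. *)
Lemma good_behead_level (T : eqType) (v : T -> nat) (e : pred T) r L x X :
    v x < r -> all (fun y => v x < v y) X ->
  has_sub (good v e r) L (x :: X) -> has_sub (good v e r) L X.
Proof.
move=> xr aX; apply: has_sub_behead => Y Z pY xY [/(_ _ xr) lY _].
have [aY _] : all (fun y => v x <= v y) Y /\ all (fun y => v x <= v y) Z.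
  by apply: all_perm_cat pY _; rewrite /= leqnn; apply: sub_all aX => y /ltnW.
have c1 : count (fun y => v y == v x) (x :: X) = 1.
  rewrite /= eqxx (_ : count _ X = 0) //; apply/eqP; rewrite -leqn0 leqNgt -has_count.
  by apply/hasPn=> y /(allP aX); rewrite ltn_neqAle eq_sym => /andP[].
have c0 : 0 < count (fun y => v y == v x) Y by rewrite -has_count; apply/hasP; exists x.
move: c1; rewrite (seq.permP pY) count_cat => c1.
by move: (lY aY); rewrite (_ : count _ Y = 1) //; lia.
Qed.

Lemma good_behead_mark (T : eqType) (v : T -> nat) (e : pred T) r L x X :
    e x -> all (predC e) X ->
  has_sub (good v e r) L (x :: X) -> has_sub (good v e r) L X.
Proof.
move=> ex; rewrite all_predC has_count -eqn0Ngt => /eqP cX.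
apply: has_sub_behead => Y Z pY xY [_].
have c0 : 0 < count e Y by rewrite -has_count; apply/hasP; exists x.
have : count e (x :: X) = 1 by rewrite /= ex cX.
by rewrite (seq.permP pY) count_cat; lia.
Qed.

(** Recovers indices from a rearrangement of values, and terms from a rearrangement of their
    types. *)
Lemma perm_map_lift (T U : eqType) (f : T -> U) W V : perm_eq (map f W) V ->
  exists2 W', perm_eq W W' & map f W' = V.
Proof.
elim: V W => [|u V IH] W pW.
  by exists [::] => //; case: W pW => // x W /perm_size.
have /mapP[w wW uw] : u \in map f W by rewrite (perm_mem pW) mem_head.
have pw := perm_to_rem wW.
have [|W' pW' <-] := IH (rem w W).
  rewrite -(perm_cons u); apply: perm_trans pW.
  by rewrite perm_sym uw -map_cons perm_map.
by exists (w :: W'); rewrite ?uw //; apply: (perm_trans pw); rewrite perm_cons.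
Qed.

(** * The ring of integers modulo n *)

Local Open Scope ring_scope.

Lemma reach_zero_sum n (I : eqType) (l : seq I) (f : I -> 'Z_n) s :
    (1 < n)%N -> uniq l ->
  reach n [seq nat_of_ord (f i) | i <- l] s <->
  exists2 a : I -> 'Z_n, forall i, i \in l -> a i \in Uset n &
    s%:R + \sum_(i <- l) a i * f i = 0.
Proof.
move=> n1; elim: l s => [|i l IH] s /=.
  move=> _; split=> [ns|[a _]].
    exists (fun _ => 0) => //; rewrite big_nil addr0.
    by apply/val_inj; rewrite /= val_Zp_nat //; apply/eqP.
  by rewrite big_nil addr0 => /(congr1 val); rewrite /= val_Zp_nat // /dvdn => ->.
move=> /andP[il ul]; split.
  move=> [c cc] /(IH _ ul)[a ua sa].
  exists (fun j => if j == i then c%:R else a j) => [j|].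
    rewrite inE; case: eqP => [_ _|_ /=]; last exact: ua.
    by rewrite inE unitZpE // coprime_sym coprime_sym.
  rewrite big_cons eqxx addrA -[f i in X in X + _]natr_Zp -natrM -natrD.
  rewrite (eq_big_seq (fun j => a j * f j)) // => j jl.
  by case: eqP => // ji; rewrite -ji jl in il.
move=> [a ua]; rewrite big_cons addrA => sa.
exists (a i : nat).
  have := ua i (mem_head _ _); rewrite inE -[a i in X in X -> _]natr_Zp unitZpE //.
apply/(IH _ ul); exists a; first by move=> j jl; apply: ua; rewrite inE jl orbT.
by rewrite natrD natrM !natr_Zp.
Qed.

Lemma has_zero_sumP n L (S : seq 'Z_n) : (1 < n)%N -> (0 < L)%N ->
  has_weighted_zero_sum_of_length (Uset n) L S <->
  has_sub (fun Y => reach n (map (@nat_of_ord _) Y) 0) L S.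
Proof.
move=> n1 L0; pose f (i : 'I_(size S)) := S`_i.
have eS : S = map f (enum 'I_(size S)).
  by rewrite -[LHS](mkseq_nth 0) /mkseq -val_enum_ord -map_comp.
split.
  move=> [I cI [_ [a ua sa]]].
  exists (map f (enum I)), (map f (enum (~: I))); split.
  - rewrite {1}eS -map_cat perm_map // uniq_perm ?enum_uniq //.
      rewrite cat_uniq !enum_uniq /= andbT; apply/hasPn=> i.
      by rewrite !mem_enum inE.
    by move=> i; rewrite mem_cat !mem_enum !inE orbN.
  - by rewrite size_map -cardE.
  rewrite -map_comp; apply/reach_zero_sum; rewrite ?enum_uniq //.
  exists a; first by move=> i; rewrite mem_enum; apply: ua.
  by rewrite add0r big_enum.
move=> [Y [Z [pY sY rY]]].
(* The rearrangement of the values is lifted to one of the indices; its first [L] indices form the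
   required set. *)
rewrite {1}eS in pY; have [W pW eW] := perm_map_lift pY.
have uW : uniq W by rewrite -(perm_uniq pW) enum_uniq.
have eY : Y = map f (take L W) by rewrite map_take eW -sY take_size_cat.
have utW : uniq (take L W) by exact: take_uniq.
have sz : size (take L W) = L by rewrite -(size_map f) -eY.
exists [set i in take L W]; first by rewrite cardsE (card_uniqP utW).
split; first by rewrite -card_gt0 cardsE (card_uniqP utW) sz.
move: rY; rewrite eY -map_comp => /(reach_zero_sum _ _ n1 utW)[a ua sa].
exists a => [i|]; first by rewrite inE; apply: ua.
by rewrite -[RHS]sa add0r [RHS]big_uniq //=; apply: eq_bigl => i; rewrite inE.
Qed.

(* The 2-adic valuation capped at [r]; [logn 2 0 = 0] forces the case split. *)
Definition lvl (r n : nat) (x : 'Z_n) : nat :=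
  if x == 0 then r else minn r (logn 2 x).

Definition mark (p n : nat) (x : 'Z_n) : bool := ~~ (p %| x)%N.

(** For [n = 2 ^ r * p] this is a complete invariant of an element up to unit factors, by
    [ty_unit_mul] and [ty_associate]. *)
Definition ty (r p n : nat) (x : 'Z_n) : nat * bool := (lvl r x, mark p x).

Lemma lvl_geq r n (x : 'Z_n) k : (k <= r)%N -> (k <= lvl r x)%N = (2 ^ k %| x)%N.
Proof.
rewrite /lvl => kr; case: eqP => [->|/eqP x0]; first by rewrite kr dvdn0.
by rewrite leq_min kr pfactor_dvdn // lt0n; apply: contra x0 => /eqP x0; apply/eqP/val_inj.
Qed.

Lemma lvl_le r n (x : 'Z_n) : (lvl r x <= r)%N.
Proof. by rewrite /lvl; case: eqP => // _; apply: geq_minl. Qed.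

Lemma lvl_eq r n (x : 'Z_n) k : (k < r)%N ->
  (lvl r x == k) = (2 ^ k %| x)%N && ~~ (2 ^ k.+1 %| x)%N.
Proof.
by move=> kr; rewrite eqn_leq andbC (lvl_geq _ (ltnW kr)) leqNgt lvl_geq.
Qed.

Lemma dvdn_Zp_nat d n k : (1 < n)%N -> (d %| n)%N ->
  (d %| (k%:R : 'Z_n))%N = (d %| k)%N.
Proof. by move=> n1 dn; rewrite val_Zp_nat // /dvdn modn_dvdm. Qed.

Lemma dvdn_Zp_int d n (z : int) : (1 < n)%N -> (d %| n)%N ->
  (d %| (z%:~R : 'Z_n))%N = (d %| `|z|)%N.
Proof.
move=> n1 dn; have e : (z%:~R : 'Z_n) = `|(z %% n)%Z|%:R.
  rewrite {1}(divz_eq z n) rmorphD rmorphM /= -[n%:~R]/(n%:R) pchar_Zp // mulr0 add0r.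
  by rewrite -[RHS]/((`|(z %% n)%Z|%N : int)%:~R) gez0_abs // modz_ge0 //; lia.
rewrite e dvdn_Zp_nat //.
have := dvdzE d (z %% n)%Z; have := dvdzE d z; rewrite /= => <- <-.
by rewrite /modz rpredDr ?rpredN; last exact: dvdz_mull.
Qed.

Lemma dvdn_unit_mul d n (u x : 'Z_n) : (1 < n)%N -> (d %| n)%N -> u \in Uset n ->
  (d %| (u * x)%R)%N = (d %| x)%N.
Proof.
move=> n1 dn; rewrite inE -{1 2}(natr_Zp u) unitZpE // => cu.
rewrite -{1}(natr_Zp x) -natrM dvdn_Zp_nat // Gauss_dvdr //.
exact: coprime_dvdl cu.
Qed.

Lemma ty_unit_mul r p n (u x : 'Z_n) : (1 < n)%N -> (2 ^ r %| n)%N -> (p %| n)%N ->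
  u \in Uset n -> ty r p (u * x) = ty r p x.
Proof.
move=> n1 rn pn uu; rewrite /ty /mark dvdn_unit_mul //; congr pair.
have le k : (k <= lvl r (u * x)%R)%N = (k <= lvl r x)%N.
  have [kr|kr] := leqP k r; last first.
    by have := lvl_le r (u * x); have := lvl_le r x; move: kr; clear; lia.
  by rewrite !lvl_geq // dvdn_unit_mul // (dvdn_trans (dvdn_exp2l 2 kr)).
by apply/eqP; rewrite eqn_leq le -le !leqnn.
Qed.

(** Among terms of level at least [k], those not divisible by [2 ^ k.+1] are the ones of level
    exactly [k]; this matches [reach_pow2] with [even_levels]. *)
Lemma good_reach r p n (Y : seq 'Z_n) : prime p -> odd p -> n = (2 ^ r * p)%N ->
  good (@lvl r n) (@mark p n) r Y <-> reach n (map (@nat_of_ord _) Y) 0.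
Proof.
move=> pp op en; set W := map _ Y; rewrite [X in reach X W]en reach_pow2_prime //.
rewrite {}/W reach_pow2 reach_prime // count_map /good.
have h : even_levels (@lvl r n) r Y <-> forall k, (k < r)%N ->
   all (fun y => 2 ^ k %| y)%N (map (@nat_of_ord _) Y) ->
     ~~ odd (count (fun y => ~~ (2 ^ k.+1 %| y)%N) (map (@nat_of_ord _) Y)).
  have e k : (k < r)%N -> all (fun y => 2 ^ k %| y)%N (map (@nat_of_ord _) Y) =
       all (fun x => k <= lvl r x)%N Y.
    by move=> kr; rewrite all_map; apply: eq_all => x /=; rewrite lvl_geq // ltnW.
  have c k : (k < r)%N -> all (fun x => k <= lvl r x)%N Y ->
     count (fun y => ~~ (2 ^ k.+1 %| y)%N) (map (@nat_of_ord _) Y) =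
     count (fun x => lvl r x == k) Y.
    move=> kr aY; rewrite count_map; apply: eq_in_count => x /(allP aY) /= kx.
    by rewrite lvl_eq // -(lvl_geq x (ltnW kr)) kx.
  by split=> h k kr; [rewrite e // => aY; rewrite c //; apply: h
    | move=> aY; rewrite -c //; apply: h; rewrite ?e].
by split=> -[a b]; split=> //; apply/h.
Qed.

(** Two terms of equal type always form a good pair, so [a x + b y] vanishes for some units [a] and
    [b], and [y] is [- a / b] times [x]. *)
Lemma ty_associate r p n (x y : 'Z_n) : prime p -> odd p -> n = (2 ^ r * p)%N ->
  (1 < n)%N -> ty r p x = ty r p y -> exists2 u, u \in Uset n & y = u * x.
Proof.
move=> pp op en n1 [vxy exy].
have : good (@lvl r n) (@mark p n) r [:: x; y].
  split=> [k kr _ /=|/=]; first by rewrite vxy; case: (_ == _).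
  by rewrite exy; case: (mark p y).
move/(good_reach _ pp op en) => /=.
case=> a ca [b cb]; rewrite add0n => d.
have ua : (a%:R : 'Z_n) \is a GRing.unit by rewrite unitZpE.
have ub : (b%:R : 'Z_n) \is a GRing.unit by rewrite unitZpE.
exists (- (b%:R^-1 * a%:R)); first by rewrite inE unitrN unitrM unitrV ub ua.
have : a%:R * x + b%:R * y = 0.
  apply/val_inj; rewrite -(natr_Zp x) -(natr_Zp y) -!natrM -natrD /= val_Zp_nat //.
  exact/eqP.
move/eqP; rewrite addrC addr_eq0 => /eqP e.
by rewrite mulNr -mulrA -mulrN -e mulKr.
Qed.

(** Unit factors do not change types, and terms of equal type differ by a unit; in the converse
    direction the global factor can be 1. *)
Lemma weight_equivP r p n (S T : seq 'Z_n) : prime p -> odd p -> n = (2 ^ r * p)%N ->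
    (1 < n)%N ->
  weight_equiv (Uset n) S T <-> perm_eq (map (@ty r p n) S) (map (@ty r p n) T).
Proof.
move=> pp op en n1.
have eS (X : seq 'Z_n) m : size X = m ->
    map (@ty r p n) X = [seq ty r p X`_(nat_of_ord i) | i <- enum 'I_m].
  move=> <-; rewrite -[in LHS](mkseq_nth 0 X) /mkseq -val_enum_ord -!map_comp.
  exact: eq_map.
have rn : (2 ^ r %| n)%N by rewrite en dvdn_mulr.
have pn : (p %| n)%N by rewrite en dvdn_mull.
split.
  move=> [sz [c [s [a [uc ua e]]]]].
  rewrite (eS _ _ erefl) (eS T _ (esym sz)).
  have tyS i : ty r p S`_(nat_of_ord i) = ty r p T`_(nat_of_ord (s i)).
    by rewrite -(ty_unit_mul _ n1 rn pn (ua i)) -e ty_unit_mul.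
  have -> : [seq ty r p S`_(nat_of_ord i) | i <- enum 'I_(size S)] =
       [seq ty r p T`_(nat_of_ord i) | i <- map s (enum 'I_(size S))].
    rewrite -[RHS]map_comp; exact: (eq_map tyS).
  apply: perm_map; apply: uniq_perm; rewrite ?(map_inj_uniq (@perm_inj _ s)) ?enum_uniq //.
  move=> i; rewrite mem_enum; apply/mapP; exists (s^-1%g i); first by rewrite mem_enum.
  by rewrite permKV.
move=> pST; have sz : size S = size T by move: (perm_size pST); rewrite !size_map.
split=> //.
move: pST; rewrite perm_sym (eS T _ (esym sz)) => /perm_map_lift[W pW eW].
have szW : size W = size S by rewrite -(perm_size pW) size_enum_ord.
have uW : uniq W by rewrite -(perm_uniq pW) enum_uniq.
(* [W] lists the indices in a new order; [f] reads it as a map on ordinals, whose injectivity makes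
   it a permutation. *)
pose f (i : 'I_(size S)) := tnth (tcast szW (in_tuple W)) i.
have fE i : f i = nth i W i by rewrite /f (tnth_nth i) val_tcast.
have fi : injective f.
  move=> i j; rewrite !fE => /eqP; rewrite (set_nth_default i) ?szW //.
  by rewrite nth_uniq ?szW // => /eqP/val_inj.
have tyf i : exists u, u \in Uset n /\ T`_(f i) = u * S`_i.
  have [|u uu e] := @ty_associate r p n S`_i T`_(f i) pp op en n1; last by exists u.
  have := congr1 (fun s => nth (ty r p (0 : 'Z_n)) s i) eW.
  by rewrite (nth_map i) ?szW // (nth_map 0) // -fE.
have [a aP] := fin_all_exists tyf.
exists 1, (perm fi), a; split=> [|i|i]; first by rewrite inE unitr1.
  by case: (aP i).
by rewrite mul1r permE; case: (aP i).
Qed.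

Notation has_good r p n L S :=
  (has_sub (good (@lvl r n) (@mark p n) r) L S).

Lemma has_zero_sum_good r p n L (S : seq 'Z_n) : prime p -> odd p ->
    n = (2 ^ r * p)%N -> (1 < n)%N -> (0 < L)%N ->
  has_weighted_zero_sum_of_length (Uset n) L S <-> has_good r p n L S.
Proof.
move=> pp op en n1 L0; rewrite has_zero_sumP //.
by split; apply: has_sub_impl => Y Z _ /(good_reach _ pp op en).
Qed.

Lemma good_ty r p n (Y Y' : seq 'Z_n) : map (@ty r p n) Y = map (@ty r p n) Y' ->
  good (@lvl r n) (@mark p n) r Y -> good (@lvl r n) (@mark p n) r Y'.
Proof.
move=> e [lY mY].
have cE a : count (fun x : 'Z_n => a (ty r p x)) Y = count (fun x : 'Z_n => a (ty r p x)) Y'.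
  by have := congr1 (count a) e; rewrite !count_map.
have aE a : all (fun x : 'Z_n => a (ty r p x)) Y = all (fun x : 'Z_n => a (ty r p x)) Y'.
  by have := congr1 (all a) e; rewrite !all_map.
split=> [k kr|]; last by rewrite -(cE snd).
rewrite -(aE (fun t => k <= t.1)%N) -(cE (fun t => t.1 == k)).
exact: lY.
Qed.

Lemma has_good_equiv r p n L (S T : seq 'Z_n) : prime p -> odd p ->
    n = (2 ^ r * p)%N -> (1 < n)%N -> weight_equiv (Uset n) S T ->
  has_good r p n L S -> has_good r p n L T.
Proof.
move=> pp op en n1 /(weight_equivP _ _ pp op en n1) pST [Y [Z [pY sY gY]]].
have : perm_eq (map (@ty r p n) T) (map (@ty r p n) (Y ++ Z)).
  by rewrite perm_sym; apply: perm_trans pST; rewrite perm_sym; apply: perm_map.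
move=> /perm_map_lift[W pW]; rewrite map_cat => eW.
have szY : size Y = size (take (size Y) W).
  by rewrite size_takel // -(size_map (@ty r p n) W) eW size_cat !size_map leq_addr.
exists (take (size Y) W), (drop (size Y) W); split.
- by rewrite cat_take_drop.
- by rewrite -szY.
apply: good_ty gY; rewrite map_take eW take_size_cat //.
by rewrite size_map.
Qed.

(** * Sequences of the three forms have no zero sum of length n *)

Lemma chainS n q b k : chain n q b k.+1 =
  rcons (chain n q b k) (((\prod_(j < k) q j)%N%:Z * b k)%:~R).
Proof. by rewrite /chain /mkseq -(addn1 k) iotaD map_cat cats1. Qed.

(** The chain is removed from its front: by induction its first [k] terms go, and then its last term
    [x] is alone at the least level if [q k] is 2, or alone prime to [p] if [q k] is [p]. As the
    whole product divides [n], this level is below [r] in the first case, and [p] does not divide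
    [Q] in the second. *)
Lemma has_good_chain r p n L q b k (Z : seq 'Z_n) : prime p -> odd p ->
    n = (2 ^ r * p)%N -> (1 < n)%N ->
    (forall i, (i < k)%N -> prime (q i)) ->
    (forall i, (i < k)%N -> coprimez (b i) (q i)) ->
    (\prod_(i < k) q i %| n)%N ->
    all (fun z : 'Z_n => \prod_(i < k) q i %| z)%N Z ->
  has_good r p n L (chain n q b k ++ Z) -> has_good r p n L Z.
Proof.
move=> pp op en n1; elim: k Z => [|k IH] Z pq cb dn dZ; first by [].
rewrite big_ord_recr /= in dn dZ; set Q := (\prod_(i < k) q i)%N in dn dZ.
rewrite chainS cat_rcons -/Q => h.
have Qn : (Q %| n)%N by apply: dvdn_trans dn; rewrite dvdn_mulr.
set x := (X in X :: Z) in h.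
have dx d : (d %| n)%N -> (d %| x)%N = (d %| Q * `|b k|)%N.
  by move=> ?; rewrite dvdn_Zp_int // abszM.
have {h} : has_good r p n L (x :: Z).
  apply: IH h => //.
  - by move=> i ik; apply: pq; rewrite ltnS ltnW.
  - by move=> i ik; apply: cb; rewrite ltnS ltnW.
  apply/andP; split; first by rewrite dx // dvdn_mulr.
  by apply: sub_all dZ => z; apply: dvdn_trans; rewrite dvdn_mulr.
have cbk : coprime `|b k| (q k) by apply: cb.
have rn : (2 ^ r %| n)%N by rewrite en dvdn_mulr.
have pn : (p %| n)%N by rewrite en dvdn_mull.
have n0 : (0 < n)%N by apply: ltnW.
have Q0 : (0 < Q)%N by apply: dvdn_gt0 Qn.
have pk : prime (q k) by apply: pq.
have qk : (q k == 2) || (q k == p).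
  have : (q k %| n)%N by apply: dvdn_trans dn; rewrite dvdn_mull.
  rewrite en Euclid_dvdM // Euclid_dvdX // !dvdn_prime2 //.
  by case/orP=> [/andP[-> _]|->]; rewrite ?orbT.
case/orP: qk => /eqP qk; rewrite qk in cbk dn dZ.
  (* Here [Q'] and [b k] are odd, so [x] has level [l], while the terms of [Z] are divisible by
     [2 ^ l.+1]. *)
  have [Q' oQ eQ] := pfactor_coprime (isT : prime 2) Q0.
  set l := logn 2 Q in eQ; rewrite coprime2n in oQ.
  have dl : (2 ^ l.+1 %| Q * 2)%N by rewrite eQ expnSr -mulnA dvdn_mull.
  have lr : (l < r)%N.
    have : (2 ^ l.+1 %| n)%N by apply: dvdn_trans dn.
    by rewrite en Gauss_dvdl ?coprimeXl ?coprime2n // dvdn_Pexp2l.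
  have ln k' : (k' <= r)%N -> (2 ^ k' %| n)%N.
    by move=> k'r; apply: dvdn_trans rn; apply: dvdn_exp2l.
  have lx : lvl r x = l.
    apply/eqP; rewrite lvl_eq // !dx ?ln ?(ltnW lr) // {1 2}eQ mulnAC dvdn_mull //=.
    rewrite expnSr mulnC dvdn_pmul2r ?expn_gt0 // dvdn2 oddM oQ /=.
    by rewrite negbK -coprimen2.
  apply: good_behead_level; rewrite lx //.
  by apply: sub_all dZ => z dz; rewrite lvl_geq //; apply: dvdn_trans dz.
apply: good_behead_mark.
  rewrite /mark dx // Euclid_dvdM // negb_or -!prime_coprime // [coprime p `|_|]coprime_sym cbk andbT.
  have : (Q * p %| 2 ^ r * p)%N by rewrite -en.
  rewrite dvdn_pmul2r ?prime_gt0 // => Qr; rewrite coprime_sym.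
  by apply: coprime_dvdl Qr _; rewrite coprimeXl ?coprime2n.
apply: sub_all dZ => z dz; rewrite /= /mark negbK.
by apply: dvdn_trans dz; rewrite dvdn_mull.
Qed.

Lemma coprime_exp2 p r : odd p -> coprime (2 ^ r) p.
Proof. by move=> op; rewrite coprimeXl ?coprime2n. Qed.

Lemma all_nseqP (T : eqType) (a : pred T) k x : a x -> all a (nseq k x).
Proof. by rewrite all_nseq => ->; rewrite orbT. Qed.

Lemma half_val r p n : (0 < r)%N -> odd p -> n = (2 ^ r * p)%N ->
  (n %/ 2 = 2 ^ r.-1 * p)%N.
Proof.
by case: r => // r _ op ->; rewrite expnS -mulnA mulKn.
Qed.

(** Once the chain is discarded only [n - 1] terms remain. *)
Lemma form_star_bad r p n (T : seq 'Z_n) : prime p -> odd p ->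
    n = (2 ^ r * p)%N -> (1 < n)%N -> form_star r T -> ~ has_good r p n n T.
Proof.
move=> pp op en n1 [q [b [pq eq cb ->]]].
move=> /(has_good_chain pp op en n1 pq cb)[||Y [Z [pY sY _]]].
- by rewrite -eq.
- by rewrite all_nseqP //= dvdn0.
by have := perm_size pY; rewrite size_cat size_nseq sY; lia.
Qed.

Lemma lvl_half r p n : (0 < r)%N -> prime p -> odd p -> n = (2 ^ r * p)%N -> (1 < n)%N ->
  lvl r ((n %/ 2)%:R : 'Z_n) = r.-1 /\ mark p ((n %/ 2)%:R : 'Z_n) = false.
Proof.
move=> r0 pp op en n1; have eh := half_val r0 op en.
have rn : (2 ^ r %| n)%N by rewrite en dvdn_mulr.
have pn : (p %| n)%N by rewrite en dvdn_mull.
have rpr : (r.-1 < r)%N by rewrite prednK.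
split; last by rewrite /mark dvdn_Zp_nat // eh dvdn_mull.
apply/eqP; rewrite lvl_eq // !dvdn_Zp_nat //; last 2 first.
- by rewrite prednK.
- by apply: dvdn_trans rn; apply: dvdn_exp2l; apply: leq_pred.
rewrite eh dvdn_mulr //= Gauss_dvdl ?coprime_exp2 // dvdn_Pexp2l //.
by rewrite ltnn.
Qed.

Lemma lvl0 r n : lvl r (0 : 'Z_n) = r.
Proof. by rewrite /lvl eqxx. Qed.

(** Discarding the chain leaves exactly [n] terms, so all are used, among them an odd number [m] at
    the least level [r.-1]. *)
Lemma form_ast_bad r p n (T : seq 'Z_n) : (0 < r)%N -> prime p -> odd p ->
    n = (2 ^ r * p)%N -> (1 < n)%N -> form_ast r T -> ~ has_good r p n n T.
Proof.
move=> r0 pp op en n1 [q [b [m [pq eq cb /and3P[om m0 mn] ->]]]].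
have [vh mh] := lvl_half r0 pp op en n1.
have eh : (n %/ 2 = \prod_(i < r) q i)%N by rewrite eq mulKn.
have dn : (\prod_(i < r) q i %| n)%N by rewrite [X in (_ %| X)%N]eq dvdn_mull.
move=> /(has_good_chain pp op en n1 pq cb dn)[].
  by rewrite all_cat !all_nseqP //= ?dvdn0 // dvdn_Zp_nat // eh.
move=> Y [Z [pY sY [lY _]]].
have Z0 : size Z = 0%N.
  by have := perm_size pY; rewrite !size_cat !size_nseq sY; lia.
move: pY; rewrite (size0nil Z0) cats0 => pY.
have rpr : (r.-1 < r)%N by rewrite prednK.
have := lY _ rpr; rewrite -(perm_all _ pY) -(seq.permP pY).
rewrite all_cat !all_nseqP ?vh ?lvl0 ?leq_pred // => /(_ isT).
rewrite count_cat !count_nseq vh lvl0 eqxx mul1n (_ : r == r.-1 = false) ?mul0n ?addn0 ?om //.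
by rewrite gtn_eqF.
Qed.

Lemma chain_const2 n a k :
  mkseq (fun i => (2 ^+ i * a i)%:~R : 'Z_n) k = chain n (fun=> 2) a k.
Proof.
apply: eq_mkseq => i; congr ((_ * _)%:~R).
by rewrite prod_nat_const card_ord -[in RHS]natz natrX.
Qed.

(** After the chain, [n + 1] terms remain, [n] of them at level [r.-1]. As [n] is even, the omitted
    term must be [c]; but then [2 ^+ r.-1] is the only term prime to [p]. *)
Lemma form_ast_ast_bad r p n (T : seq 'Z_n) : (0 < r)%N -> prime p -> odd p ->
    n = (2 ^ r * p)%N -> (1 < n)%N -> form_ast_ast r T -> ~ has_good r p n n T.
Proof.
move=> r0 pp op en n1 [a [c [oa dc ->]]].
rewrite chain_const2 subn1 in oa *.
have [vh mh] := lvl_half r0 pp op en n1.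
have rn : (2 ^ r %| n)%N by rewrite en dvdn_mulr.
have pn : (p %| n)%N by rewrite en dvdn_mull.
have rpr : (r.-1 < r)%N by rewrite prednK.
have ln k : (k <= r)%N -> (2 ^ k %| n)%N.
  by move=> kr; apply: dvdn_trans rn; apply: dvdn_exp2l.
have prodr : (\prod_(i < r.-1) 2 = 2 ^ r.-1)%N by rewrite prod_nat_const card_ord.
have n_even : odd n = false by rewrite en oddM oddX; case: (r) r0.
have vc : lvl r (c%:~R : 'Z_n) = r.
  apply/eqP; rewrite eqn_leq lvl_le lvl_geq // dvdn_Zp_int //.
  by move: dc; rewrite dvdzE abszX.
have v2 : lvl r (2 ^+ r.-1 : 'Z_n) = r.-1.
  rewrite -natrX; apply/eqP; rewrite lvl_eq // !dvdn_Zp_nat ?ln ?prednK ?leq_pred //.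
  by rewrite dvdnn dvdn_Pexp2l // -ltnNge.
have m2 : mark p (2 ^+ r.-1 : 'Z_n).
  by rewrite -natrX /mark dvdn_Zp_nat // -prime_coprime // coprime_sym coprime_exp2.
have eh := half_val r0 op en.
have cop i : (i < r.-1)%N -> coprimez (a i) 2.
  by move=> ir; have := oa i ir; rewrite dvdzE dvdn2 negbK -coprimen2.
have pq i : (i < r.-1)%N -> prime ((fun=> 2%N) i) by [].
move=> /(has_good_chain pp op en n1 pq cop)[||Y [Z [pY sY [lY mY]]]].
- by rewrite prodr ln // leq_pred.
- rewrite prodr /= -!(lvl_geq _ (leq_pred r)) vc v2 leqnn leq_pred /=.
  by apply: all_nseqP; rewrite /= -(lvl_geq _ (leq_pred r)) vh.
have sZ : size Z = 1%N.
  by have := perm_size pY; rewrite size_cat /= size_nseq sY; lia.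
case: Z sZ pY => [|z [|? ?]] //= _ pY.
have rr : (r == r.-1) = false by rewrite gtn_eqF.
have lG : all (fun x : 'Z_n => r.-1 <= lvl r x)%N Y.
  have : all (fun x : 'Z_n => r.-1 <= lvl r x)%N (Y ++ [:: z]).
    by rewrite -(perm_all _ pY) /= vc v2 leqnn leq_pred all_nseqP //= vh.
  by rewrite all_cat => /andP[].
have cG := seq.permP pY (fun x : 'Z_n => lvl r x == r.-1).
rewrite /= count_nseq count_cat /= vc v2 vh eqxx rr addn0 mul1n add0n in cG.
have zv : lvl r z != r.-1.
  apply/negP=> zv.
  have cY : count (fun x : 'Z_n => lvl r x == r.-1) Y = n.-1.
    by move: cG; rewrite zv; move: n1; clear; lia.
  by have := lY _ rpr lG; rewrite [count _ _]cY; move: n_even n1; clear; lia.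
have zc : z = c%:~R.
  have : z \in c%:~R :: 2 ^+ r.-1 :: nseq (n - 1) (n %/ 2)%:R.
    by rewrite (perm_mem pY) mem_cat mem_head orbT.
  rewrite !inE mem_nseq => /or3P[/eqP //|/eqP e|/andP[_ /eqP e]]; move: zv; rewrite e ?v2 ?vh eqxx //.
have cM := seq.permP pY (@mark p n).
move: mY cM; rewrite /= count_nseq count_cat /= mh m2 zc mul0n.
by case: (mark p c%:~R); lia.
Qed.

(** * Recovering the forms from the shapes *)

(** The prime sequences built below have [p] at the position [j] of the marked term, and 2
    elsewhere. *)
Lemma prod_insert p j k :
  (\prod_(i < k) (if i == j :> nat then p else 2) =
     if k <= j then 2 ^ k else 2 ^ k.-1 * p)%N.
Proof.
elim: k => [|k IH]; first by rewrite big_ord0.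
rewrite big_ord_recr /= IH; case: (ltngtP k j) => kj.
- by rewrite expnSr.
- by rewrite mulnAC -expnSr prednK // (leq_ltn_trans _ kj).
- by [].
Qed.

(** [b i] is the quotient of the term by the partial product; it is prime to [q i] because the next
    partial product does not divide the term. *)
Lemma chain_exists n q (W : seq 'Z_n) :
    (forall i, (i < size W)%N -> prime (q i)) ->
    (forall i, (i < size W)%N -> (\prod_(j < i) q j %| (W`_i)%R)%N) ->
    (forall i, (i < size W)%N -> ~~ (\prod_(j < i.+1) q j %| (W`_i)%R)%N) ->
  exists2 b : nat -> int, forall i, (i < size W)%N -> coprimez (b i) (q i)
    & W = chain n q b (size W).
Proof.
move=> pq dq ndq; exists (fun i => ((W`_i)%R %/ \prod_(j < i) q j)%N) => [i iW|].
  rewrite coprimezE /= coprime_sym prime_coprime ?pq //; apply: contra (ndq i iW).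
  move=> /dvdnP[t et]; rewrite big_ord_recr /= -(divnK (dq i iW)) et.
  by rewrite -mulnA [(q i * _)%N]mulnC dvdn_mull.
apply: (@eq_from_nth _ 0) => [|i iW]; first by rewrite size_mkseq.
rewrite nth_mkseq // -PoszM mulnC divnK ?dq // -[LHS]natr_Zp.
by [].
Qed.

(** The marked [d] takes the place of [p]. Terms before it are measured by powers of 2 alone; those
    after it are unmarked, hence divisible by [p], and their positions run one ahead of their
    levels. *)
Lemma chain_of_levels r p n j k (A B : seq 'Z_n) d : prime p -> odd p ->
    map (@lvl r n) A = iota 0 j -> mark p d -> (j <= lvl r d)%N ->
    map (@lvl r n) B = iota j k -> all (predC (@mark p n)) B -> (j + k <= r)%N ->
  exists2 b : nat -> int,
    forall i, (i < j + k.+1)%N -> coprimez (b i) (if i == j then p else 2)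
    & A ++ d :: B = chain n (fun i => if i == j then p else 2) b (j + k.+1).
Proof.
move=> pp op vA md vd vB mB jkr.
have sA : size A = j by rewrite -(size_map (@lvl r n)) vA size_iota.
have sB : size B = k by rewrite -(size_map (@lvl r n)) vB size_iota.
have sW : size (A ++ d :: B) = (j + k.+1)%N by rewrite size_cat /= sA sB.
have lA i : (i < j)%N -> lvl r A`_i = i.
  move=> ij; have := congr1 (fun s => nth 0%N s i) vA.
  by rewrite (nth_map 0) ?sA // nth_iota.
have lB i : (i < k)%N -> lvl r B`_i = (j + i)%N.
  move=> ik; have := congr1 (fun s => nth 0%N s i) vB.
  by rewrite (nth_map 0) ?sB // nth_iota.
have jr : (j <= r)%N by apply: leq_trans jkr; apply: leq_addr.
rewrite -sW; apply: chain_exists => i; rewrite sW => iW.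
- by case: ifP.
- rewrite prod_insert nth_cat sA; case: (ltngtP i j) => ij.
  + by rewrite -(@lvl_geq r) ?lA // (leq_trans (ltnW ij)).
  + have [t et] : exists t, i = (j + t.+1)%N by exists (i - j).-1; move: ij; clear; lia.
    have tk : (t < k)%N by move: iW; rewrite et ltn_add2l.
    rewrite et addKn addnS /=; rewrite Gauss_dvd ?coprime_exp2 // -(@lvl_geq r) ?lB //; last first.
      by apply: leq_trans jkr; rewrite leq_add2l ltnW.
    rewrite leqnn /=; apply/negPn/(allP mB); apply: mem_nth; by rewrite sB.
  + by rewrite ij subnn /= -(@lvl_geq r).
rewrite prod_insert nth_cat sA; case: (ltngtP i j) => ij.
- have := lA i ij => /eqP; rewrite lvl_eq => [/andP[] //|].
  exact: leq_trans ij jr.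
- have [t et] : exists t, i = (j + t.+1)%N by exists (i - j).-1; move: ij; clear; lia.
  have tk : (t < k)%N by move: iW; rewrite et ltn_add2l.
  have := lB t tk => /eqP; rewrite lvl_eq; last by apply: leq_trans jkr; rewrite ltn_add2l.
  rewrite et addKn addnS /= => /andP[_]; apply: contra; apply: dvdn_trans.
  exact: dvdn_mulr.
- rewrite ij subnn /=; apply: contra md; apply: dvdn_trans; exact: dvdn_mull.
Qed.

Lemma Zp_eq0 r p n (x : 'Z_n) : odd p -> n = (2 ^ r * p)%N -> (1 < n)%N ->
  (r <= lvl r x)%N -> ~~ mark p x -> x = 0.
Proof.
move=> op en n1; rewrite lvl_geq // negbK => d2 dp.
have : (n %| x)%N by rewrite [X in (X %| _)%N]en Gauss_dvd ?coprime_exp2 // d2.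
rewrite -{2}(natr_Zp x) => /dvdnP[k ->].
by rewrite natrM pchar_Zp // mulr0.
Qed.

(** [x] is a multiple of [n %/ 2], and its level excludes an even factor. *)
Lemma Zp_eq_half r p n (x : 'Z_n) : (0 < r)%N -> odd p -> n = (2 ^ r * p)%N -> (1 < n)%N ->
  lvl r x = r.-1 -> ~~ mark p x -> x = (n %/ 2)%:R.
Proof.
move=> r0 op en n1 /eqP; rewrite lvl_eq ?prednK // negbK => /andP[d2 nd2] dp.
have eh := half_val r0 op en.
have : (n %/ 2 %| x)%N by rewrite eh Gauss_dvd ?coprime_exp2 // d2.
case/dvdnP=> k ek; have ok : odd k.
  apply: contraR nd2; rewrite -dvdn2 ek eh => d2k.
  by rewrite mulnA dvdn_mulr // -{1}(prednK r0) expnS dvdn_mul.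
have e2 : (k * (n %/ 2) = n %/ 2 + k./2 * n)%N.
  have en2 : n = (n %/ 2 * 2)%N by rewrite eh mulnAC -expnSr prednK.
  by rewrite -{1}(odd_double_half k) ok [in RHS]en2; lia.
by rewrite -(natr_Zp x) ek e2 natrD natrM pchar_Zp // mulr0 addr0.
Qed.

Lemma all_eq_nseq (T : eqType) (a : pred T) x (X : seq T) :
  (forall y, a y -> y = x) -> all a X -> X = nseq (size X) x.
Proof. by move=> ax aX; apply/all_pred1P; apply: sub_all aX => y /ax ->; rewrite /= eqxx. Qed.

Lemma weight_equiv_perm r p n (S T : seq 'Z_n) : prime p -> odd p ->
  n = (2 ^ r * p)%N -> (1 < n)%N -> perm_eq S T -> weight_equiv (Uset n) S T.
Proof. by move=> pp op en n1 /(perm_map (@ty r p n)) /(weight_equivP _ _ pp op en n1). Qed.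

Lemma shape_star_form r m p n (S : seq 'Z_n) : prime p -> odd p ->
    n = (2 ^ r * p)%N -> (1 < n)%N -> r = m.+1 -> size S = (n + r)%N ->
    shape_star (@lvl r n) (@mark p n) 0 m S ->
  exists2 T, weight_equiv (Uset n) S T & form_star r T.
Proof.
move=> pp op en n1 er szS [A [d [Z [pS vA md vd aZ]]]]; rewrite add0n -er in vd aZ vA.
exists (A ++ d :: Z); first exact: weight_equiv_perm pp op en n1 pS.
have rr : (r + 0 <= r)%N by rewrite addn0.
have [b cb eA] := chain_of_levels (k := 0) (B := [::]) pp op vA md vd erefl isT rr.
have sA : size A = r by rewrite -(size_map (@lvl r n)) vA size_iota.
have eZ : Z = nseq (n - 1) 0.
  rewrite {1}(@all_eq_nseq _ _ 0 _ _ aZ); last first.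
    by move=> y /andP[vy my]; apply: Zp_eq0 op en n1 vy my.
  by congr nseq; have := perm_size pS; rewrite szS size_cat /= sA; clear; lia.
exists (fun i => if i == r then p else 2%N), b; split.
- by move=> i _; case: ifP.
- by rewrite prod_insert ltnn.
- by move=> i ir; apply: cb; rewrite addn1.
- by rewrite -eZ -[r.+1]addn1 -eA -catA.
Qed.

Lemma shape_ast_form r m p n (S : seq 'Z_n) : prime p -> odd p ->
    n = (2 ^ r * p)%N -> (1 < n)%N -> r = m.+1 -> size S = (n + r)%N ->
    shape_ast (@lvl r n) (@mark p n) 0 m S ->
  exists2 T, weight_equiv (Uset n) S T & form_ast r T.
Proof.
move=> pp op en n1 er szS [j [A [d [B [M [Z [[pS jm vA md vd] [vB mB aM oM aZ]]]]]]]].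
rewrite !add0n -?er in vd vB aM aZ vA.
exists (A ++ d :: B ++ M ++ Z); first exact: weight_equiv_perm pp op en n1 pS.
have rr : (j + (m - j) <= r)%N by rewrite subnKC // er.
have [b cb eA] := chain_of_levels pp op vA md vd vB mB rr.
have ejr : (j + (m - j).+1 = r)%N by rewrite addnS subnKC.
rewrite ejr in cb eA.
have sA : size A = j by rewrite -(size_map (@lvl r n)) vA size_iota.
have sB : size B = (m - j)%N by rewrite -(size_map (@lvl r n)) vB size_iota.
have r0 : (0 < r)%N by rewrite er.
have eM : M = nseq (size M) (n %/ 2)%:R.
  apply: all_eq_nseq aM => y /andP[/eqP vy my].
  by apply: Zp_eq_half op en n1 _ my; rewrite // vy er.
have sMZ : (size M + size Z)%N = n.
  by have := perm_size pS; rewrite szS !size_cat /= !size_cat sA sB -ejr; clear; lia.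
have eZ : Z = nseq (n - size M) 0.
  rewrite {1}(@all_eq_nseq _ _ 0 _ _ aZ); last first.
    by move=> y /andP[vy my]; apply: Zp_eq0 op en n1 vy my.
  by congr nseq; rewrite -[LHS](addKn (size M)) sMZ.
exists (fun i => if i == j then p else 2%N), b, (size M); split=> //.
- by move=> i _; case: ifP.
- by rewrite prod_insert er ltnNge jm /= mulnA -expnS -er.
- by rewrite oM odd_gt0 //=; have := leq_addr (size Z) (size M); rewrite sMZ.
- by rewrite -eM -eZ -eA -catA.
Qed.

(** Here [d] need not equal [2 ^+ (r - 1)] but has its type, so the equivalence comes from types and
    not from a mere rearrangement. *)
Lemma shape_ast_ast_form r m p n (S : seq 'Z_n) : prime p -> odd p ->
    n = (2 ^ r * p)%N -> (1 < n)%N -> r = m.+1 -> size S = (n + r)%N ->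
    shape_ast_ast (@lvl r n) (@mark p n) 0 m S ->
  exists2 T, weight_equiv (Uset n) S T & form_ast_ast r T.
Proof.
move=> pp op en n1 er szS [A [c [d [M [pS vA vc [vd md] aM]]]]].
rewrite !add0n -?er in vA vd vc aM.
have sA : size A = m by rewrite -(size_map (@lvl r n)) vA size_iota.
have r0 : (0 < r)%N by rewrite er.
have rn : (2 ^ r %| n)%N by rewrite en dvdn_mulr.
have pn : (p %| n)%N by rewrite en dvdn_mull.
have mr : m = (r - 1)%N by rewrite er subn1.
have eM : M = nseq (n - 1) (n %/ 2)%:R.
  rewrite {1}(@all_eq_nseq _ _ (n %/ 2)%:R _ _ aM); last first.
    move=> y /andP[/eqP vy my].
    by apply: Zp_eq_half op en n1 _ my; rewrite // vy er.
  by congr nseq; have := perm_size pS; rewrite szS size_cat /= sA er; clear; lia.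
have lA i : (i < m)%N -> lvl r A`_i = i.
  move=> ij; have := congr1 (fun s => nth 0%N s i) vA.
  by rewrite (nth_map 0) ?sA // nth_iota.
have prod2 k : (\prod_(i < k) 2 = 2 ^ k)%N by rewrite prod_nat_const card_ord.
have dA i : (i < m)%N -> (2 ^ i %| (A`_i)%R)%N && ~~ (2 ^ i.+1 %| (A`_i)%R)%N.
  by move=> im; rewrite -(@lvl_eq r) ?lA // er ltnW.
have [a oa eA] : exists2 a : nat -> int, forall i, (i < size A)%N -> coprimez (a i) 2
    & A = chain n (fun=> 2%N) a (size A).
  apply: chain_exists => i; rewrite ?prod2 ?sA // => /dA /andP[] //.
have v2 : ty r p d = ty r p (2 ^+ (r - 1) : 'Z_n).
  rewrite /ty vd md -natrX; congr pair; last first.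
    by rewrite /mark dvdn_Zp_nat // -prime_coprime // coprime_sym coprime_exp2.
  apply/esym/eqP; rewrite lvl_eq ?er // -er !dvdn_Zp_nat //; last first.
    by apply: dvdn_trans rn; rewrite dvdn_exp2l // er.
  by rewrite -mr dvdnn dvdn_Pexp2l // er ltnn.
exists (A ++ [:: c; 2 ^+ (r - 1)] ++ nseq (n - 1) (n %/ 2)%:R).
  apply/(weight_equivP _ _ pp op en n1); apply: perm_trans (perm_map _ pS) _.
  by rewrite !map_cat /= -v2 -eM.
exists a, (c : nat); split.
- by move=> i; rewrite -mr -sA => /oa; rewrite dvdzE dvdn2 negbK -coprimen2.
- by rewrite dvdzE abszX /= -(@lvl_geq r) // er.
- by rewrite chain_const2 -mr -sA -eA; congr (_ ++ _ :: _); rewrite -[LHS]natr_Zp.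
Qed.

(** * The Gao constant and its extremal sequences *)

Lemma form_star_exists r p n : prime p -> odd p -> n = (2 ^ r * p)%N ->
  exists2 T : seq 'Z_n, size T = (r.+1 + (n - 1))%N & form_star r T.
Proof.
move=> pp op en.
exists (chain n (fun i => if i == r then p else 2%N) (fun=> 1) r.+1 ++ nseq (n - 1) 0).
  by rewrite size_cat size_mkseq size_nseq.
exists (fun i => if i == r then p else 2%N), (fun=> 1); split=> //.
- by move=> i _; case: ifP.
- by rewrite prod_insert ltnn.
- by move=> i _; apply: coprime1n.
Qed.

Lemma modulus_even_ge4 r p n : (0 < r)%N -> prime p -> odd p ->
  n = (2 ^ r * p)%N -> ~~ odd n /\ (4 <= n)%N.
Proof.
move=> r0 pp op en; split; first by rewrite en oddM oddX; case: (r) r0.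
have p3 : (2 < p)%N by case: (p) pp op => [|[|[|]]].
have : (2 ^ 1 * 3 <= 2 ^ r * p)%N by rewrite leq_mul // leq_exp2l.
by rewrite -en; apply: leq_trans.
Qed.

Lemma gao_constant_Uset r p n : (0 < r)%N -> prime p -> odd p -> n = (2 ^ r * p)%N ->
  is_gao_constant (Uset n) (n + r + 1).
Proof.
move=> r0 pp op en.
have [n_even n4] := modulus_even_ge4 r0 pp op en.
have n1 : (1 < n)%N by apply: leq_trans n4.
have n0 : (0 < n)%N by apply: ltnW.
split=> [|S szS|k k0 gk].
- by rewrite addn1.
- rewrite (has_zero_sum_good _ pp op en n1 n0).
  apply: (@has_good_sub _ _ _ r 0) => //; first by apply/allP=> x _.
  by rewrite szS addn1.
rewrite leqNgt addn1 ltnS; apply/negP=> kn.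
(* If some [k] at most [n + r] had the property, a prefix of [T] would contain a zero sum of length
   [n], and so would [T]. *)
have [T szT fT] := form_star_exists pp op en.
have szT' : (k <= size T)%N by rewrite szT; move: kn n0; clear; lia.
have := gk (take k T); rewrite size_takel // => /(_ erefl).
rewrite (has_zero_sum_good _ pp op en n1 n0) => h.
case: (form_star_bad pp op en n1 fT).
apply: (has_sub_perm _ (has_sub_catl (drop k T) h)).
by rewrite perm_sym perm_catC cat_take_drop.
Qed.

Lemma gao_extremalP r p n (S : seq 'Z_n) : (0 < r)%N -> prime p -> odd p ->
    n = (2 ^ r * p)%N -> (1 < n)%N ->
  gao_extremal (Uset n) S <-> size S = (n + r)%N /\ ~ has_good r p n n S.
Proof.
move=> r0 pp op en n1; have n0 : (0 < n)%N by apply: ltnW.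
have gn := gao_constant_Uset r0 pp op en.
have P := has_zero_sum_good S pp op en n1 n0.
split=> [[k [k0 gk mk] [szS nS]]|[szS nS]].
  case: gn => g0 gg mg.
  have ek : k = (n + r + 1)%N by apply/eqP; rewrite eqn_leq mk // mg.
  by split; [rewrite szS ek addnK | move/P].
by exists (n + r + 1)%N => //; rewrite addnK; split=> // /P.
Qed.

Local Close Scope ring_scope.

Theorem theorem6 (n r p : nat) (hp : prime p) (hodd : odd p) (hr : 2 <= r)
    (hn : n = 2 ^ r * p) (S : seq 'Z_n) (hS : exactly_one_odd_term S) :
  gao_extremal (Uset n) S <->
  exists2 T : seq 'Z_n, weight_equiv (Uset n) S T
    & [\/ form_star r T, form_ast r T | form_ast_ast r T].
Proof.
have r0 : (0 < r)%N by exact: ltnW.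
have [n_even n4] := modulus_even_ge4 r0 hp hodd hn.
have n1 : (1 < n)%N by apply: leq_trans n4.
rewrite (gao_extremalP _ r0 hp hodd hn n1); split=> [[szS nS]|[T eST fT]].
  (* The constrained levels run from 0 to [r.-1], so the shapes are taken with [s = 0] and
     [m = r.-1]. *)
  have er : r = r.-1.+1 by rewrite prednK.
  have szS' : size S = (n + r.-1.+1)%N by rewrite -er.
  have [||h|h|h] := @no_good_sub_shape _ (@lvl r n) (@mark p n) r.-1 0 n S n_even n4 _ szS'.
  - by apply/allP.
  - by rewrite add0n -er.
  - by have [T e f] := shape_star_form hp hodd hn n1 er szS h; exists T; [|apply: Or31].
  - by have [T e f] := shape_ast_form hp hodd hn n1 er szS h; exists T; [|apply: Or32].
  - by have [T e f] := shape_ast_ast_form hp hodd hn n1 er szS h; exists T; [|apply: Or33].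
(* Equivalence preserves the length and, through types, the existence of a zero sum, so it suffices
   to treat [T]. *)
have szT : size T = (n + r)%N.
  case: fT => [[q [b [_ _ _ ->]]]|[q [b [m [_ _ _ /and3P[_ _ mn] ->]]]]|[a [c [_ _ ->]]]];
    rewrite !size_cat size_mkseq /= !size_nseq.
  - by move: n1; clear; lia.
  - by move: mn; clear; lia.
  - by move: n1 r0; clear; lia.
split; first by case: eST => ->.
move/(has_good_equiv hp hodd hn n1 eST); case: fT => f.
- exact: form_star_bad f.
- exact: form_ast_bad f.
- exact: form_ast_ast_bad f.
Qed.
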